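(* Let $\mathbb{F}$ be a field of characteristic 0. Every multilinear identity of degree 5 satisfied by the pre-Lie triple products $[a,b,c]_1=(a\cdot b)\cdot c$ and $[a,b,c]_2=a\cdot(b\cdot c)$, where $a\cdot b=a\prec b-b\succ a$, in the free dendriform dialgebra over $\mathbb{F}$ (that is, every element of $\ker\mathcal{E}_5\subseteq\mathrm{TT}_5$) is a consequence of (i.e. lies in the $S_5$-submodule of $\mathrm{TT}_5$ generated by) the 12 liftings to degree 5 of $\mathrm{TRS}(a,b,c)=[a,b,c]_1-[a,c,b]_1-[a,b,c]_2+[a,c,b]_2$ together with the following three identities (which are themselves identities for the pre-Lie triple products): $$\begin{aligned} &[[a,b,c]_1,d,e]_2-[[a,d,e]_2,b,c]_1+[a,[d,e,b]_1,c]_1-[a,[b,d,e]_2,c]_1\\ &\quad+[a,b,[d,e,c]_1]_1-[a,b,[c,d,e]_2]_1\equiv0, \end{aligned}$$ $$\begin{aligned} &[[a,b,c]_1,d,e]_1-[[a,d,b]_1,c,e]_1+[[a,d,c]_1,b,e]_1-[[a,c,b]_1,d,e]_1\\ &\quad-[a,[b,c,d]_1,e]_1+[a,[d,b,c]_1,e]_1-[a,[d,c,b]_1,e]_1+[a,[c,b,d]_1,e]_1\equiv0, \end{aligned}$$ $$\begin{aligned} &[[a,b,c]_1,d,e]_2-[[a,d,e]_2,b,c]_1+[[a,d,e]_2,b,c]_2-[[a,b,c]_2,d,e]_2\\ &\quad+[a,[d,e,b]_1,c]_1+[a,[d,e,c]_1,b]_1-[a,[b,c,e]_1,d]_1-[a,[d,e,c]_1,b]_2\\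 &\quad+[a,[b,c,e]_1,d]_2-[a,[b,d,e]_2,c]_1-[a,[c,d,e]_2,b]_1-[a,[d,b,c]_2,e]_2\\ &\quad+[a,[b,d,e]_2,c]_2+[a,[c,d,e]_2,b]_2+[a,d,[b,c,e]_1]_1-[a,d,[e,b,c]_2]_2\equiv0. \end{aligned}$$
   Context: A dendriform dialgebra over $\mathbb{F}$ is a vector space with two bilinear operations $\prec,\succ$ satisfying, for all $x,y,z$: $(x\succ y)\prec z = x\succ(y\prec z)$; $(x\prec y)\prec z = x\prec(y\prec z)+x\prec(y\succ z)$; $x\succ(y\succ z)=(x\succ y)\succ z+(x\prec y)\succ z$. $\mathrm{DD}_n$ denotes the multilinear subspace of degree $n$ of the free dendriform dialgebra on $x_1,\dots,x_n$ over $\mathbb{F}$. $\mathrm{TT}_n$ ($n$ odd) denotes the multilinear subspace of degree $n$ of the free (nonassociative) algebra on $x_1,\dots,x_n$ with two trilinear operations $[x,y,z]_1,[x,y,z]_2$ and no relations. $S_n$ acts on both by permuting the variables, $\sigma\cdot x_i=x_{\sigma(i)}$. The expansion map $\mathcal{E}_n\colon\mathrm{TT}_n\to\mathrm{DD}_n$ is the linear map that replaces each occurrence of $[x,y,z]_1$ by $(x\cdot y)\cdot z$ and each occurrence of $[x,y,z]_2$ by $x\cdot(y\cdot z)$, where $x\cdot y=x\prec y-y\succ x$. The multilinear identities of degree $n$ satisfied by the pre-Lie triple products are the elements of $\ker\mathcal{E}_n$. The letters $a,b,c,d,e$ denote $x_1,\dots,x_5$. The 12 liftings of $\mathrm{TRS}(a,b,c)$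 to degree 5 are, for $i=1,2$: $\mathrm{TRS}([a,d,e]_i,b,c)$, $\mathrm{TRS}(a,[b,d,e]_i,c)$, $\mathrm{TRS}(a,b,[c,d,e]_i)$, $[\mathrm{TRS}(a,b,c),d,e]_i$, $[d,\mathrm{TRS}(a,b,c),e]_i$, $[d,e,\mathrm{TRS}(a,b,c)]_i$. *)

(* Defs.v *)
From HB Require Import structures.
From mathcomp Require Import all_boot all_order perm all_algebra.
From mathcomp Require Import boolp.
From mathcomp Require Import freeg.

Set Implicit Arguments.
Unset Strict Implicit.
Unset Printing Implicit Defensive.

Import GRing.Theory.
Local Open Scope ring_scope.
Local Open Scope quotient_scope.

(* {freeg K / F} is the F-vector space with basis K, << k >> the basis vector
   of k, and fglift f the linear extension of f : K -> V. *)
Section FgliftLinear.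
Variables (F : fieldType) (K : choiceType) (V : lmodType F) (f : K -> V).

Lemma fglift_linear : linear (fglift f).
Proof.
pose A := GRing.isAdditive.Build _ _ (fglift f) (lift_is_additive f).
pose g : {additive {freeg K / F} -> V} := HB.pack (fglift f) A.
move=> c u v.
have gE x : fglift f x = g x by [].
rewrite !gE raddfD; congr (_ + _).
have -> : c *: u = fgscale c u by [].
rewrite -[in RHS](freeg_sumE u) !raddf_sum.
by apply: eq_bigr => x _; rewrite -!gE !liftU [RHS]scalerA.
Qed.

HB.instance Definition _ :=
  GRing.isLinear.Build F {freeg K / F} V *:%R (fglift f) fglift_linear.

Lemma fgliftU1 k : fglift f << k >> = f k.
Proof. by rewrite liftU scale1r. Qed.

End FgliftLinear.

Lemma freeg_linear_ext (F : fieldType) (K : choiceType) (V : lmodType F)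
    (g h : {freeg K / F} -> V) :
  linear g -> linear h -> (forall k, g << k >> = h << k >>) -> g =1 h.
Proof.
move=> lg lh e u.
pose g' : {linear {freeg K / F} -> V} :=
  HB.pack g (GRing.isLinear.Build F {freeg K / F} V *:%R g lg).
pose h' : {linear {freeg K / F} -> V} :=
  HB.pack h (GRing.isLinear.Build F {freeg K / F} V *:%R h lh).
rewrite -[u]freeg_sumE [g _](linear_sum g') [h _](linear_sum h').
apply: eq_bigr => k _.
have -> : << coeff k u *g k >> = coeff k u *: (<< k >> : {freeg K / F}).
  by apply/eqP/freeg_eqP => x; rewrite coeffZ !coeffU mul1r.
by rewrite !linearZ /= e.
Qed.

HB.mixin Record Lmodule_isDendriform (F : fieldType) V of GRing.Lmodule F V := {
  dprec : V -> V -> V;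
  dsucc : V -> V -> V;
  dprec_linearl : forall y, linear (dprec^~ y);
  dprec_linearr : forall x, linear (dprec x);
  dsucc_linearl : forall y, linear (dsucc^~ y);
  dsucc_linearr : forall x, linear (dsucc x);
  dsucc_prec : forall x y z, dprec (dsucc x y) z = dsucc x (dprec y z);
  dprec_prec : forall x y z,
    dprec (dprec x y) z = dprec x (dprec y z) + dprec x (dsucc y z);
  dsucc_succ : forall x y z,
    dsucc x (dsucc y z) = dsucc (dsucc x y) z + dsucc (dprec x y) z
}.

#[short(type="dendriformType")]
HB.structure Definition Dendriform (F : fieldType) :=
  {V of GRing.Lmodule F V & Lmodule_isDendriform F V}.

Declare Scope dendriform_scope.
Delimit Scope dendriform_scope with dend.
Local Open Scope dendriform_scope.
Notation "x ≺ y" := (dprec x y) (at level 40, left associativity) : dendriform_scope.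
Notation "x ≻ y" := (dsucc x y) (at level 40, left associativity) : dendriform_scope.

Section PreLie.
Variables (F : fieldType) (D : dendriformType F).
Implicit Types x y z : D.

Definition prelie x y : D := x ≺ y - y ≻ x.
Definition prelie1 x y z : D := prelie (prelie x y) z.
Definition prelie2 x y z : D := prelie x (prelie y z).
End PreLie.

Inductive dtree (X : Type) : Type :=
  | DLeaf of X
  | DPrec of dtree X & dtree X
  | DSucc of dtree X & dtree X.

Fixpoint dleaves (X : Type) (t : dtree X) : seq X :=
  match t with
  | DLeaf x => [:: x]
  | DPrec t1 t2 | DSucc t1 t2 => dleaves t1 ++ dleaves t2
  end.

(* TOne and TTwo stand for [_,_,_]_1 and [_,_,_]_2. *)
Inductive ttree (X : Type) : Type :=
  | TLeaf of X
  | TOne of ttree X & ttree X & ttree X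
  | TTwo of ttree X & ttree X & ttree X.

Fixpoint tleaves (X : Type) (t : ttree X) : seq X :=
  match t with
  | TLeaf x => [:: x]
  | TOne t1 t2 t3 | TTwo t1 t2 t3 => tleaves t1 ++ tleaves t2 ++ tleaves t3
  end.

Fixpoint tmap (X Y : Type) (f : X -> Y) (t : ttree X) : ttree Y :=
  match t with
  | TLeaf x => TLeaf (f x)
  | TOne t1 t2 t3 => TOne (tmap f t1) (tmap f t2) (tmap f t3)
  | TTwo t1 t2 t3 => TTwo (tmap f t1) (tmap f t2) (tmap f t3)
  end.

Section TreeChoice.
Variable X : Type.

Fixpoint dtree_encode (t : dtree X) : GenTree.tree X :=
  match t with
  | DLeaf x => GenTree.Leaf x
  | DPrec t1 t2 => GenTree.Node 0 [:: dtree_encode t1; dtree_encode t2]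
  | DSucc t1 t2 => GenTree.Node 1 [:: dtree_encode t1; dtree_encode t2]
  end.

Fixpoint dtree_decode (t : GenTree.tree X) : option (dtree X) :=
  match t with
  | GenTree.Leaf x => Some (DLeaf x)
  | GenTree.Node k [:: t1; t2] =>
    match dtree_decode t1, dtree_decode t2 with
    | Some u1, Some u2 => Some (if k is 0%N then DPrec u1 u2 else DSucc u1 u2)
    | _, _ => None
    end
  | _ => None
  end.

Lemma dtree_encodeK : pcancel dtree_encode dtree_decode.
Proof. by elim=> //= t1 -> t2 ->. Qed.

Fixpoint ttree_encode (t : ttree X) : GenTree.tree X :=
  match t with
  | TLeaf x => GenTree.Leaf x
  | TOne t1 t2 t3 =>
    GenTree.Node 0 [:: ttree_encode t1; ttree_encode t2; ttree_encode t3]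
  | TTwo t1 t2 t3 =>
    GenTree.Node 1 [:: ttree_encode t1; ttree_encode t2; ttree_encode t3]
  end.

Fixpoint ttree_decode (t : GenTree.tree X) : option (ttree X) :=
  match t with
  | GenTree.Leaf x => Some (TLeaf x)
  | GenTree.Node k [:: t1; t2; t3] =>
    match ttree_decode t1, ttree_decode t2, ttree_decode t3 with
    | Some u1, Some u2, Some u3 =>
      Some (if k is 0%N then TOne u1 u2 u3 else TTwo u1 u2 u3)
    | _, _, _ => None
    end
  | _ => None
  end.

Lemma ttree_encodeK : pcancel ttree_encode ttree_decode.
Proof. by elim=> //= t1 -> t2 -> t3 ->. Qed.
End TreeChoice.

HB.instance Definition _ (X : eqType) :=
  Equality.copy (dtree X) (pcan_type (@dtree_encodeK X)).
HB.instance Definition _ (X : choiceType) :=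
  Choice.copy (dtree X) (pcan_type (@dtree_encodeK X)).
HB.instance Definition _ (X : eqType) :=
  Equality.copy (ttree X) (pcan_type (@ttree_encodeK X)).
HB.instance Definition _ (X : choiceType) :=
  Choice.copy (ttree X) (pcan_type (@ttree_encodeK X)).

Lemma linear_subr (F : fieldType) (U V : lmodType F) (f : U -> V) :
  linear f -> {morph f : x y / x - y}.
Proof. by move=> lf x y; rewrite addrC -scaleN1r lf scaleN1r addrC. Qed.

Section FreeDendriform.
Variables (F : fieldType) (X : choiceType).

Local Notation mag := {freeg (dtree X) / F}.
Implicit Types u v w : mag.

Definition mprec u v : mag :=
  fglift (fun s => fglift (fun t => (<< DPrec s t >> : mag)) v) u.
Definition msucc u v : mag :=
  fglift (fun s => fglift (fun t => (<< DSucc s t >> : mag)) v) u.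

Lemma fglift2_linearr (op : dtree X -> dtree X -> mag) u :
  linear (fun v => fglift (fun s => fglift (op s) v) u).
Proof.
move=> c v w; rewrite -[u]freeg_sumE !linear_sum -big_split /=.
by apply: eq_bigr => s _; rewrite !liftU linearP scalerDr !scalerA mulrC.
Qed.

Lemma mprec_linearl v : linear (mprec^~ v).
Proof. by move=> c u w; rewrite /mprec linearP. Qed.
Lemma mprec_linearr u : linear (mprec u).
Proof. exact: fglift2_linearr. Qed.
Lemma msucc_linearl v : linear (msucc^~ v).
Proof. by move=> c u w; rewrite /msucc linearP. Qed.
Lemma msucc_linearr u : linear (msucc u).
Proof. exact: fglift2_linearr. Qed.

(* The two-sided ideal generated by the three dendriform relations. *)
Inductive dend_ideal : mag -> Prop :=
  | DI_succ_prec u v w :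
      dend_ideal (mprec (msucc u v) w - msucc u (mprec v w))
  | DI_prec_prec u v w :
      dend_ideal (mprec (mprec u v) w - (mprec u (mprec v w) + mprec u (msucc v w)))
  | DI_succ_succ u v w :
      dend_ideal (msucc u (msucc v w) - (msucc (msucc u v) w + msucc (mprec u v) w))
  | DI_zero : dend_ideal 0
  | DI_lin c u v : dend_ideal u -> dend_ideal v -> dend_ideal (c *: u + v)
  | DI_precl u v : dend_ideal u -> dend_ideal (mprec u v)
  | DI_precr u v : dend_ideal v -> dend_ideal (mprec u v)
  | DI_succl u v : dend_ideal u -> dend_ideal (msucc u v)
  | DI_succr u v : dend_ideal v -> dend_ideal (msucc u v).

Definition dend_idealb : {pred mag} := fun u => `[< dend_ideal u >].

Lemma dend_idealb_submod : submod_closed dend_idealb.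
Proof.
split; first by apply/asboolP/DI_zero.
by move=> c u v /asboolP Iu /asboolP Iv; apply/asboolP/DI_lin.
Qed.
HB.instance Definition _ :=
  GRing.isSubmodClosed.Build F mag dend_idealb dend_idealb_submod.

Definition free_dend : Type := Quotient.quot dend_idealb.
HB.instance Definition _ := GRing.Zmodule.on free_dend.

Definition dclass u : free_dend := \pi_(Quotient.quot dend_idealb) u.

Lemma dclass_surj (x : free_dend) : exists u, x = dclass u.
Proof. by exists (repr x); rewrite /dclass reprK. Qed.

Lemma dclassP u v : dclass u = dclass v <-> dend_ideal (u - v).
Proof.
split=> [/eqP|I]; first by rewrite -Quotient.idealrBE => /asboolP.
by apply/eqP; rewrite -Quotient.idealrBE; apply/asboolP.
Qed.

Lemma dclassD u v : dclass (u + v) = dclass u + dclass v.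
Proof. exact: (@raddfD _ _ (\pi_(Quotient.quot dend_idealb))). Qed.

Lemma dclass0 : dclass 0 = 0.
Proof. exact: (@raddf0 _ _ (\pi_(Quotient.quot dend_idealb))). Qed.

Definition fd_scale (c : F) (x : free_dend) : free_dend := dclass (c *: repr x).

Lemma dend_ideal_repr u : dend_ideal (repr (dclass u) - u).
Proof. by apply/dclassP; rewrite /dclass reprK. Qed.

Lemma dend_idealZ c u : dend_ideal u -> dend_ideal (c *: u).
Proof. by move=> Iu; rewrite -[c *: u]addr0; apply: DI_lin => //; apply: DI_zero. Qed.

Lemma dend_idealD u v : dend_ideal u -> dend_ideal v -> dend_ideal (u + v).
Proof. by move=> Iu Iv; rewrite -[u]scale1r; apply: DI_lin. Qed.

Lemma fd_scaleE c u : fd_scale c (dclass u) = dclass (c *: u).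
Proof. by apply/dclassP; rewrite -scalerBr; apply/dend_idealZ/dend_ideal_repr. Qed.

Lemma fd_scaleA a b x : fd_scale a (fd_scale b x) = fd_scale (a * b) x.
Proof. by have [u ->] := dclass_surj x; rewrite !fd_scaleE scalerA. Qed.
Lemma fd_scale1 : left_id 1 fd_scale.
Proof. by move=> x; have [u ->] := dclass_surj x; rewrite fd_scaleE scale1r. Qed.
Lemma fd_scaleDr : right_distributive fd_scale +%R.
Proof.
move=> c x y; have [u ->] := dclass_surj x; have [v ->] := dclass_surj y.
by rewrite -dclassD !fd_scaleE -dclassD scalerDr.
Qed.
Lemma fd_scaleDl x : {morph fd_scale^~ x : a b / a + b}.
Proof.
by move=> a b; have [u ->] := dclass_surj x; rewrite !fd_scaleE -dclassD scalerDl.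
Qed.

HB.instance Definition _ := GRing.Zmodule_isLmodule.Build F free_dend
  fd_scaleA fd_scale1 fd_scaleDr fd_scaleDl.

Lemma dclass_linear : linear dclass.
Proof. by move=> c u v; rewrite dclassD -fd_scaleE. Qed.
HB.instance Definition _ :=
  GRing.isLinear.Build F mag free_dend *:%R dclass dclass_linear.

Definition fd_prec (x y : free_dend) : free_dend := dclass (mprec (repr x) (repr y)).
Definition fd_succ (x y : free_dend) : free_dend := dclass (msucc (repr x) (repr y)).

Lemma fd_precE u v : fd_prec (dclass u) (dclass v) = dclass (mprec u v).
Proof.
apply/dclassP; set u' := repr _; set v' := repr _.
have -> : mprec u' v' - mprec u v = mprec (u' - u) v' + mprec u (v' - v).
  rewrite (linear_subr (mprec_linearl v')) (linear_subr (mprec_linearr u)).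
  by rewrite addrA subrK.
by apply: dend_idealD; [apply: DI_precl|apply: DI_precr]; apply: dend_ideal_repr.
Qed.

Lemma fd_succE u v : fd_succ (dclass u) (dclass v) = dclass (msucc u v).
Proof.
apply/dclassP; set u' := repr _; set v' := repr _.
have -> : msucc u' v' - msucc u v = msucc (u' - u) v' + msucc u (v' - v).
  rewrite (linear_subr (msucc_linearl v')) (linear_subr (msucc_linearr u)).
  by rewrite addrA subrK.
by apply: dend_idealD; [apply: DI_succl|apply: DI_succr]; apply: dend_ideal_repr.
Qed.

Lemma fd_prec_linearl y : linear (fd_prec^~ y).
Proof.
move=> c x z; have [u ->] := dclass_surj x; have [w ->] := dclass_surj z.
have [v ->] := dclass_surj y.
by rewrite -linearP !fd_precE mprec_linearl linearP.
Qed.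
Lemma fd_prec_linearr x : linear (fd_prec x).
Proof.
move=> c y z; have [u ->] := dclass_surj x; have [w ->] := dclass_surj z.
have [v ->] := dclass_surj y.
by rewrite -linearP !fd_precE mprec_linearr linearP.
Qed.
Lemma fd_succ_linearl y : linear (fd_succ^~ y).
Proof.
move=> c x z; have [u ->] := dclass_surj x; have [w ->] := dclass_surj z.
have [v ->] := dclass_surj y.
by rewrite -linearP !fd_succE msucc_linearl linearP.
Qed.
Lemma fd_succ_linearr x : linear (fd_succ x).
Proof.
move=> c y z; have [u ->] := dclass_surj x; have [w ->] := dclass_surj z.
have [v ->] := dclass_surj y.
by rewrite -linearP !fd_succE msucc_linearr linearP.
Qed.

Lemma fd_succ_prec x y z : fd_prec (fd_succ x y) z = fd_succ x (fd_prec y z).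
Proof.
have [u ->] := dclass_surj x; have [v ->] := dclass_surj y.
have [w ->] := dclass_surj z; rewrite !(fd_precE, fd_succE).
by apply/dclassP/DI_succ_prec.
Qed.
Lemma fd_prec_prec x y z :
  fd_prec (fd_prec x y) z = fd_prec x (fd_prec y z) + fd_prec x (fd_succ y z).
Proof.
have [u ->] := dclass_surj x; have [v ->] := dclass_surj y.
have [w ->] := dclass_surj z; rewrite !(fd_precE, fd_succE) -dclassD.
by apply/dclassP/DI_prec_prec.
Qed.
Lemma fd_succ_succ x y z :
  fd_succ x (fd_succ y z) = fd_succ (fd_succ x y) z + fd_succ (fd_prec x y) z.
Proof.
have [u ->] := dclass_surj x; have [v ->] := dclass_surj y.
have [w ->] := dclass_surj z; rewrite !(fd_precE, fd_succE) -dclassD.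
by apply/dclassP/DI_succ_succ.
Qed.

HB.instance Definition _ := Lmodule_isDendriform.Build F free_dend
  fd_prec_linearl fd_prec_linearr fd_succ_linearl fd_succ_linearr
  fd_succ_prec fd_prec_prec fd_succ_succ.

Definition dgen (x : X) : free_dend := dclass << DLeaf x >>.

End FreeDendriform.

Arguments dgen F {X} x.

Section FreeDendriformUniversal.
Variables (F : fieldType) (X : choiceType) (D : dendriformType F) (f : X -> D).

Local Notation mag := {freeg (dtree X) / F}.

Fixpoint deval_tree (t : dtree X) : D :=
  match t with
  | DLeaf x => f x
  | DPrec t1 t2 => deval_tree t1 ≺ deval_tree t2
  | DSucc t1 t2 => deval_tree t1 ≻ deval_tree t2
  end.

Definition deval : mag -> D := fglift deval_tree.
HB.instance Definition _ := GRing.Linear.on deval.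


Lemma deval_prec u v : deval (mprec u v) = deval u ≺ deval v.
Proof.
move: u; apply: freeg_linear_ext => [c u w|c u w|s].
- by rewrite mprec_linearl linearP.
- by rewrite linearP dprec_linearl.
rewrite /mprec /deval !fgliftU1; move: v; apply: freeg_linear_ext => [c u w|c u w|t].
- by rewrite !linearP.
- by rewrite linearP dprec_linearr.
by rewrite !fgliftU1.
Qed.

Lemma deval_succ u v : deval (msucc u v) = deval u ≻ deval v.
Proof.
move: u; apply: freeg_linear_ext => [c u w|c u w|s].
- by rewrite msucc_linearl linearP.
- by rewrite linearP dsucc_linearl.
rewrite /msucc /deval !fgliftU1; move: v; apply: freeg_linear_ext => [c u w|c u w|t].
- by rewrite !linearP.
- by rewrite linearP dsucc_linearr.
by rewrite !fgliftU1.
Qed.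

Lemma linear_fun0 (U V : lmodType F) (g : U -> V) : linear g -> g 0 = 0.
Proof. by move=> lg; rewrite -(subrr 0) (linear_subr lg) subrr. Qed.

Lemma deval_linear : linear deval. Proof. exact: linearP. Qed.
Lemma devalB : {morph deval : u v / u - v}. Proof. exact: linearB. Qed.
Lemma devalD : {morph deval : u v / u + v}. Proof. exact: linearD. Qed.

Lemma deval_ideal u : dend_ideal u -> deval u = 0.
Proof.
elim=> {u} [u v w|u v w|u v w||c u v _ IHu _ IHv|u v _ IH|u v _ IH|u v _ IH|u v _ IH].
- by rewrite devalB !(deval_prec, deval_succ) dsucc_prec subrr.
- by rewrite devalB devalD !(deval_prec, deval_succ) dprec_prec subrr.
- by rewrite devalB devalD !(deval_prec, deval_succ) dsucc_succ subrr.
- by rewrite linear0.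
- by rewrite deval_linear IHu IHv scaler0 addr0.
- by rewrite deval_prec IH (linear_fun0 (dprec_linearl _)).
- by rewrite deval_prec IH (linear_fun0 (dprec_linearr _)).
- by rewrite deval_succ IH (linear_fun0 (dsucc_linearl _)).
- by rewrite deval_succ IH (linear_fun0 (dsucc_linearr _)).
Qed.

Definition fd_lift (x : free_dend F X) : D := deval (repr x).

Lemma fd_liftE u : fd_lift (dclass u) = deval u.
Proof.
apply/eqP; rewrite -subr_eq0 -devalB; apply/eqP/deval_ideal.
exact: dend_ideal_repr.
Qed.

Theorem free_dend_universal :
  [/\ linear fd_lift, {morph fd_lift : x y / x ≺ y}, {morph fd_lift : x y / x ≻ y}
    & forall x, fd_lift (dgen F x) = f x] /\
  forall h : free_dend F X -> D,
    linear h -> {morph h : x y / x ≺ y} -> {morph h : x y / x ≻ y} ->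
    (forall x, h (dgen F x) = f x) -> h =1 fd_lift.
Proof.
have liftl : linear fd_lift.
  move=> c x y; have [u ->] := dclass_surj x; have [v ->] := dclass_surj y.
  by rewrite -linearP !fd_liftE deval_linear.
split.
  split=> // [x y|x y|x].
  - have [u ->] := dclass_surj x; have [v ->] := dclass_surj y.
    by rewrite [_ ≺ _]fd_precE !fd_liftE deval_prec.
  - have [u ->] := dclass_surj x; have [v ->] := dclass_surj y.
    by rewrite [_ ≻ _]fd_succE !fd_liftE deval_succ.
  - by rewrite fd_liftE /deval fgliftU1.
move=> h hl hp hs hg x; have [u ->] := dclass_surj x; rewrite fd_liftE.
move: u; apply: freeg_linear_ext => [c u v|c u v|t].
- by rewrite linearP hl.
- by rewrite linearP.
rewrite /deval fgliftU1; elim: t => [y|s IHs t IHt|s IHs t IHt] /=.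
- by rewrite -hg.
- rewrite -IHs -IHt -hp; congr h; rewrite [_ ≺ _]fd_precE.
  by rewrite /mprec !fgliftU1.
- rewrite -IHs -IHt -hs; congr h; rewrite [_ ≻ _]fd_succE.
  by rewrite /msucc !fgliftU1.
Qed.

End FreeDendriformUniversal.

(* The free algebra on x_1, ..., x_n with two trilinear operations and no
   relations; x_(i+1) is the leaf i : 'I_n. *)
Notation triple_free F n := {freeg (ttree 'I_n) / F}.

Section TripleFree.
Variables (F : fieldType) (n : nat).
Implicit Types u v w : triple_free F n.

Definition tvar (i : 'I_n) : triple_free F n := << TLeaf i >>.

Definition top1 u v w : triple_free F n :=
  fglift (fun r => fglift (fun s => fglift
    (fun t => (<< TOne r s t >> : triple_free F n)) w) v) u.
Definition top2 u v w : triple_free F n :=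
  fglift (fun r => fglift (fun s => fglift
    (fun t => (<< TTwo r s t >> : triple_free F n)) w) v) u.

Definition TT : {pred triple_free F n} :=
  fun u => all (fun t => perm_eq (tleaves t) (enum 'I_n)) (dom u).

Definition Sn_act (s : 'S_n) u : triple_free F n :=
  fglift (fun t => (<< tmap s t >> : triple_free F n)) u.

Inductive Sn_submodule (G : seq (triple_free F n)) : triple_free F n -> Prop :=
  | SnS_gen g : g \in G -> Sn_submodule G g
  | SnS_zero : Sn_submodule G 0
  | SnS_lin c u v : Sn_submodule G u -> Sn_submodule G v -> Sn_submodule G (c *: u + v)
  | SnS_act s u : Sn_submodule G u -> Sn_submodule G (Sn_act s u).

Fixpoint expand_tree (t : ttree 'I_n) : free_dend F 'I_n :=
  match t with
  | TLeaf i => dgen F i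
  | TOne t1 t2 t3 => prelie1 (expand_tree t1) (expand_tree t2) (expand_tree t3)
  | TTwo t1 t2 t3 => prelie2 (expand_tree t1) (expand_tree t2) (expand_tree t3)
  end.

(* The map E_n is the restriction of expand to TT; it takes values in DD, see
   expand_TT_DD. *)
Definition expand : triple_free F n -> free_dend F 'I_n := fglift expand_tree.

Definition ker_expand : {pred triple_free F n} :=
  fun u => (u \in TT) && (expand u == 0).

(* The span of the monomials whose word of variables is a rearrangement of s. *)
Inductive dend_span (s : seq 'I_n) : free_dend F 'I_n -> Prop :=
  | DS_mon t : perm_eq (dleaves t) s -> dend_span s (dclass << t >>)
  | DS_zero : dend_span s 0
  | DS_lin c x y : dend_span s x -> dend_span s y -> dend_span s (c *: x + y).

Definition DD : free_dend F 'I_n -> Prop := dend_span (enum 'I_n).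

Lemma dend_span_perm s1 s2 x : perm_eq s1 s2 -> dend_span s1 x -> dend_span s2 x.
Proof.
move=> e; elim=> [t p||c y z _ IHy _ IHz]; [|exact: DS_zero|exact: DS_lin].
exact/DS_mon/(perm_trans p e).
Qed.

Lemma dend_span_op (op : free_dend F 'I_n -> free_dend F 'I_n -> free_dend F 'I_n)
    (con : dtree 'I_n -> dtree 'I_n -> dtree 'I_n) s1 s2 x y :
  (forall z, linear (op^~ z)) -> (forall z, linear (op z)) ->
  (forall t1 t2, op (dclass << t1 >>) (dclass << t2 >>) = dclass << con t1 t2 >>) ->
  (forall t1 t2, dleaves (con t1 t2) = dleaves t1 ++ dleaves t2) ->
  dend_span s1 x -> dend_span s2 y -> dend_span (s1 ++ s2) (op x y).
Proof.
move=> ll lr oE cE Sx Sy; elim: Sx => [t1 p1||c z z' _ IH _ IH'].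
- elim: Sy => [t2 p2||c z z' _ IH _ IH'].
  + by rewrite oE; apply: DS_mon; rewrite cE perm_cat.
  + by rewrite (linear_fun0 (lr _)); apply: DS_zero.
  + by rewrite lr; apply: DS_lin.
- by rewrite (linear_fun0 (ll _)); apply: DS_zero.
- by rewrite ll; apply: DS_lin.
Qed.

Lemma dend_span_prelie s1 s2 x y :
  dend_span s1 x -> dend_span s2 y -> dend_span (s1 ++ s2) (prelie x y).
Proof.
move=> Sx Sy; rewrite /prelie addrC -scaleN1r; apply: DS_lin.
- apply: (@dend_span_perm (s2 ++ s1)); first by rewrite perm_catC.
  apply: (@dend_span_op _ (@DSucc _)) => //.
  + exact: dsucc_linearl.
  + exact: dsucc_linearr.
  + by move=> t1 t2; rewrite [_ ≻ _]fd_succE /msucc !fgliftU1.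
- apply: (@dend_span_op _ (@DPrec _)) => //.
  + exact: dprec_linearl.
  + exact: dprec_linearr.
  + by move=> t1 t2; rewrite [_ ≺ _]fd_precE /mprec !fgliftU1.
Qed.

Lemma expand_tree_span t : dend_span (tleaves t) (expand_tree t).
Proof.
elim: t => [i|t1 S1 t2 S2 t3 S3|t1 S1 t2 S2 t3 S3] /=; first exact: DS_mon.
- by rewrite catA; do 2?apply: dend_span_prelie.
- by do 2?apply: dend_span_prelie.
Qed.

Lemma expand_TT_DD u : u \in TT -> DD (expand u).
Proof.
move=> /allP Mu; rewrite -[u]freeg_sumE /expand linear_sum big_seq.
elim/big_rec: _ => [|t x ut Sx]; first exact: DS_zero.
rewrite /= liftU; apply: DS_lin => //.
exact: dend_span_perm (Mu _ ut) (expand_tree_span t).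
Qed.

Definition TRS u v w : triple_free F n :=
  top1 u v w - top1 u w v - top2 u v w + top2 u w v.

Section Identities.
Variables a b c d e : triple_free F n.

Definition TRS_liftings_by (op : triple_free F n -> triple_free F n ->
    triple_free F n -> triple_free F n) : seq (triple_free F n) :=
  [:: TRS (op a d e) b c; TRS a (op b d e) c; TRS a b (op c d e);
      op (TRS a b c) d e; op d (TRS a b c) e; op d e (TRS a b c)].

Definition TRS_liftings : seq (triple_free F n) :=
  TRS_liftings_by top1 ++ TRS_liftings_by top2.

Definition identity1 : triple_free F n :=
    top2 (top1 a b c) d e - top1 (top2 a d e) b c
  + top1 a (top1 d e b) c - top1 a (top2 b d e) c
  + top1 a b (top1 d e c) - top1 a b (top2 c d e).

Definition identity2 : triple_free F n :=
    top1 (top1 a b c) d e - top1 (top1 a d b) c e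
  + top1 (top1 a d c) b e - top1 (top1 a c b) d e
  - top1 a (top1 b c d) e + top1 a (top1 d b c) e
  - top1 a (top1 d c b) e + top1 a (top1 c b d) e.

Definition identity3 : triple_free F n :=
    top2 (top1 a b c) d e - top1 (top2 a d e) b c
  + top2 (top2 a d e) b c - top2 (top2 a b c) d e
  + top1 a (top1 d e b) c + top1 a (top1 d e c) b
  - top1 a (top1 b c e) d - top2 a (top1 d e c) b
  + top2 a (top1 b c e) d - top1 a (top2 b d e) c
  - top1 a (top2 c d e) b - top2 a (top2 d b c) e
  + top2 a (top2 b d e) c + top2 a (top2 c d e) b
  + top1 a d (top1 b c e) - top2 a d (top2 e b c).

End Identities.

End TripleFree.

Arguments tvar F {n} i.
Arguments TT F n : clear implicits.
Arguments DD F n : clear implicits.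
Arguments ker_expand F n : clear implicits.

(* Main.v *)
(* The product [a · b = a ≺ b - b ≻ a] is right-symmetric (pre-Lie), and the three
   identities are explicit combinations of right-symmetry relators; hence they lie in
   the kernel.

   Conversely, on the space spanned by the words over {0, ..., 4}, setting
   [x ≺ y = xy] if [min x < min y] (else 0) and [x ≻ y = xy] if [min y <= min x]
   (else 0) defines a dendriform algebra, in which [x · y] is [xy - yx] or 0 when x
   and y have no common letter.  Substituting the letter [p i] for [x_i], for all
   bijections [p] fixing 0, and taking coefficients of words beginning with 0 gives
   linear functionals that vanish on the kernel of the expansion map and see only
   the monomials whose leftmost variable is x_0.  On the 288 monomials of TT_5 with
   that property these functionals have rank 125, and Gaussian elimination over the
   integers shows that their common kernel, of dimension 163, is spanned by
   permuted copies of the 15 generators.  The monomials with another leftmost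
   variable are reached by transpositions. *)
Require Import Defs.
From HB Require Import structures.
From mathcomp Require Import all_boot all_algebra.
From mathcomp Require Import perm.
From mathcomp Require Import freeg zify.

Set Implicit Arguments.
Unset Strict Implicit.
Unset Printing Implicit Defensive.

Import GRing.Theory.
Local Open Scope ring_scope.
Local Open Scope dendriform_scope.

(** Plain lists with integer coefficients, so that one run of [vm_compute] serves all fields [F];
    [comb_eval] carries the outcome into a module. *)
Definition comb (K : Type) := seq (K * int).

(** * Integer combinations *)

Section CombEval.
Variables (F : fieldType) (W : lmodType F) (K : Type) (val : K -> W).

Definition comb_eval (l : comb K) : W := \sum_(x <- l) x.2%:~R *: val x.1.

Lemma comb_eval_nil : comb_eval [::] = 0.
Proof. exact: big_nil. Qed.

Lemma comb_eval_cons x l : comb_eval (x :: l) = x.2%:~R *: val x.1 + comb_eval l.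
Proof. exact: big_cons. Qed.

Lemma comb_eval_cat l1 l2 : comb_eval (l1 ++ l2) = comb_eval l1 + comb_eval l2.
Proof. exact: big_cat. Qed.

Lemma comb_eval1 k : comb_eval [:: (k, 1)] = val k.
Proof. by rewrite comb_eval_cons comb_eval_nil scale1r addr0. Qed.

Definition scale_comb (a : int) (l : comb K) : comb K := [seq (x.1, a * x.2) | x <- l].

Lemma comb_eval_scale a l : comb_eval (scale_comb a l) = a%:~R *: comb_eval l.
Proof.
rewrite /comb_eval big_map scaler_sumr; apply: eq_bigr => x _ /=.
by rewrite scalerA intrM.
Qed.

Definition sub_comb (l1 l2 : comb K) : comb K := l1 ++ scale_comb (-1) l2.

Lemma comb_eval_sub l1 l2 : comb_eval (sub_comb l1 l2) = comb_eval l1 - comb_eval l2.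
Proof. by rewrite comb_eval_cat comb_eval_scale mulrN1z scaleN1r. Qed.

Lemma comb_eval_flatten ls : comb_eval (flatten ls) = \sum_(l <- ls) comb_eval l.
Proof.
elim: ls => [|l ls IH]; first by rewrite big_nil comb_eval_nil.
by rewrite big_cons -IH -comb_eval_cat.
Qed.

End CombEval.

Lemma comb_eval_map (F : fieldType) (W : lmodType F) (K1 K2 : Type) (val : K2 -> W)
    (g : K1 -> K2) l :
  comb_eval val [seq (g x.1, x.2) | x <- l] = comb_eval (val \o g) l.
Proof. by rewrite /comb_eval big_map. Qed.

Lemma linear_comb_eval (F : fieldType) (W1 W2 : lmodType F) (K : Type) (val : K -> W1)
    (h : W1 -> W2) l :
  linear h -> h (comb_eval val l) = comb_eval (h \o val) l.
Proof.
move=> lh; elim: l => [|x l IH]; first by rewrite !comb_eval_nil (linear_fun0 lh).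
by rewrite !comb_eval_cons lh IH.
Qed.

Section CombMap.
Variables (F : fieldType) (W1 W2 W3 W4 : lmodType F) (K1 K2 K3 K4 : Type).
Variables (val1 : K1 -> W1) (val2 : K2 -> W2) (val3 : K3 -> W3) (val4 : K4 -> W4).

Definition bilin_comb (f : K1 -> K2 -> comb K3) (l1 : comb K1) (l2 : comb K2) : comb K3 :=
  flatten [seq scale_comb (x.2 * y.2) (f x.1 y.1) | x <- l1, y <- l2].

Lemma comb_eval_bilin (f : K1 -> K2 -> comb K3) (op : W1 -> W2 -> W3) l1 l2 :
  (forall y, linear (op^~ y)) -> (forall x, linear (op x)) ->
  (forall x y, comb_eval val3 (f x y) = op (val1 x) (val2 y)) ->
  comb_eval val3 (bilin_comb f l1 l2) = op (comb_eval val1 l1) (comb_eval val2 l2).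
Proof.
move=> ll lr fE; rewrite comb_eval_flatten big_allpairs_dep /=.
rewrite (linear_comb_eval val1 l1 (ll _)); apply: eq_bigr => x _ /=.
rewrite (linear_comb_eval val2 l2 (lr _)) scaler_sumr; apply: eq_bigr => y _ /=.
by rewrite comb_eval_scale fE intrM scalerA.
Qed.

Definition trilin_comb (f : K1 -> K2 -> K3 -> K4) (l1 : comb K1) (l2 : comb K2)
    (l3 : comb K3) : comb K4 :=
  flatten [seq [seq (f x.1 y.1 z.1, x.2 * y.2 * z.2) | z <- l3] | x <- l1, y <- l2].

Lemma comb_eval_trilin (f : K1 -> K2 -> K3 -> K4) (op : W1 -> W2 -> W3 -> W4) l1 l2 l3 :
  (forall y z, linear (fun x => op x y z)) -> (forall x z, linear (fun y => op x y z)) ->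
  (forall x y, linear (op x y)) ->
  (forall x y z, val4 (f x y z) = op (val1 x) (val2 y) (val3 z)) ->
  comb_eval val4 (trilin_comb f l1 l2 l3) =
  op (comb_eval val1 l1) (comb_eval val2 l2) (comb_eval val3 l3).
Proof.
move=> lx ly lz fE; rewrite comb_eval_flatten big_allpairs_dep /=.
rewrite (linear_comb_eval val1 l1 (lx _ _)); apply: eq_bigr => x _ /=.
rewrite (linear_comb_eval val2 l2 (ly _ _)) scaler_sumr; apply: eq_bigr => y _ /=.
rewrite (linear_comb_eval val3 l3 (lz _ _)) !scaler_sumr /comb_eval big_map.
by apply: eq_bigr => z _ /=; rewrite fE !intrM !scalerA.
Qed.

End CombMap.

(** * Gaussian elimination *)

Section Lexicographic.

Fixpoint lexcmp (s t : seq nat) : comparison :=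
  match s, t with
  | [::], [::] => Eq
  | [::], _ :: _ => Lt
  | _ :: _, [::] => Gt
  | m :: s', n :: t' => if Nat.compare m n is Eq then lexcmp s' t' else Nat.compare m n
  end.

Definition lexlt s t := if lexcmp s t is Lt then true else false.

Lemma nat_compareP m n :
  (Nat.compare m n = Eq /\ m = n) \/ (Nat.compare m n = Lt /\ (m < n)%N) \/
  (Nat.compare m n = Gt /\ (n < m)%N).
Proof.
elim: m n => [|m IH] [|n] /=; auto.
by case: (IH n) => [[-> ->]|[[-> ?]|[-> ?]]]; auto.
Qed.

Lemma lexcmp_eq s t : lexcmp s t = Eq -> s = t.
Proof.
elim: s t => [|m s IH] [|n t] //=.
by case: (nat_compareP m n) => [[-> ->] /IH ->|[[-> _]|[-> _]]].
Qed.

Lemma lexlt_irr s : lexlt s s = false.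
Proof.
rewrite /lexlt; elim: s => //= m s IH.
by case: (nat_compareP m m) => [[-> _]|[[-> ]|[-> ]]] //; rewrite ltnn.
Qed.

Lemma lexlt_trans : transitive lexlt.
Proof.
rewrite /lexlt => t s u; elim: t s u => [|n t IH] [|m s] [|k u] //=.
case: (nat_compareP m n) => [[-> ->]|[[-> mn]|[-> //]]].
  by case: (nat_compareP n k) => [[-> _]|[[-> _]|[-> _]]] //; exact: IH.
case: (nat_compareP n k) => [[_ nk]|[[_ nk]|[-> //]]] _ _;
case: (nat_compareP m k) => [[_ mk]|[[-> //]|[_ mk]]]; lia.
Qed.

End Lexicographic.

Section Gauss.
Local Notation vec := (comb (seq nat)).

(** A merge of two lists sorted by key, in which cancelling entries disappear. [comb_eval_lincomb]
    holds for arbitrary lists; sortedness is tested where it matters, by [echelon]. *)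
Fixpoint lincomb (a : int) (v : vec) (b : int) : vec -> vec :=
  fix lincomb_v (w : vec) : vec :=
  match v, w with
  | [::], _ => scale_comb b w
  | _ :: _, [::] => scale_comb a v
  | x :: v', y :: w' =>
    match lexcmp x.1 y.1 with
    | Lt => (x.1, a * x.2) :: lincomb a v' b w
    | Gt => (y.1, b * y.2) :: lincomb_v w'
    | Eq => if a * x.2 + b * y.2 is Posz 0 then lincomb a v' b w'
            else (x.1, a * x.2 + b * y.2) :: lincomb a v' b w'
    end
  end.

(** Insertion sort with addition of coefficients at equal keys. *)
Definition collect (v : vec) : vec := foldr (fun x w => lincomb 1 [:: x] 1 w) [::] v.

(* Rows are sorted by pivot, the key of their first entry.  Elimination is by
   cross-multiplication, so that recovering [v] from the result requires
   characteristic 0. *)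
Fixpoint insert (rows : seq vec) (v : vec) : seq vec :=
  match v with
  | [::] => rows
  | x :: _ =>
    match rows with
    | [::] => [:: v]
    | r :: rows' =>
      match r with
      | [::] => r :: insert rows' v
      | y :: _ =>
        match lexcmp x.1 y.1 with
        | Lt => v :: rows
        | Gt => r :: insert rows' v
        | Eq => r :: insert rows' (if y.2 == 0 then v else lincomb y.2 v (- x.2) r)
        end
      end
    end
  end.

Definition gauss : seq vec -> seq vec -> seq vec := foldl insert.

Lemma insert_cons x v y r rows : insert ((y :: r) :: rows) (x :: v) =
  match lexcmp x.1 y.1 with
  | Lt => (x :: v) :: (y :: r) :: rows
  | Gt => (y :: r) :: insert rows (x :: v)
  | Eq => (y :: r) ::
      insert rows (if y.2 == 0 then x :: v else lincomb y.2 (x :: v) (- x.2) (y :: r))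
  end.
Proof. by []. Qed.

Variables (F : fieldType) (charF0 : [pchar F] =i pred0) (W : lmodType F).
Variable val : seq nat -> W.
Local Notation ev := (comb_eval val).

Lemma comb_eval_lincomb a v b w : ev (lincomb a v b w) = a%:~R *: ev v + b%:~R *: ev w.
Proof.
elim: v w => [|x v IHv] w.
  have -> : lincomb a [::] b w = scale_comb b w by case: w.
  by rewrite comb_eval_scale comb_eval_nil scaler0 add0r.
elim: w => [|y w IHw].
  have -> : lincomb a (x :: v) b [::] = scale_comb a (x :: v) by [].
  by rewrite comb_eval_scale comb_eval_nil scaler0 addr0.
rewrite [lincomb _ _ _ _]/=; case E: (lexcmp x.1 y.1).
- have -> : ev (if a * x.2 + b * y.2 is Posz 0 then lincomb a v b w
            else (x.1, a * x.2 + b * y.2) :: lincomb a v b w)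
     = (a * x.2 + b * y.2)%:~R *: val x.1 + ev (lincomb a v b w).
    case: (a * x.2 + b * y.2) => [[|n]|n]; rewrite ?comb_eval_cons //.
    by rewrite scale0r add0r.
  rewrite IHv !comb_eval_cons (lexcmp_eq E) !scalerDr !scalerA -!intrM intrD scalerDl.
  by rewrite !addrA; congr (_ + _); rewrite -!addrA; congr (_ + _); rewrite addrC.
- by rewrite comb_eval_cons IHv !comb_eval_cons /= !scalerDr !scalerA -!intrM -!addrA.
- rewrite comb_eval_cons /= -/(lincomb a (x :: v) b w) IHw.
  rewrite !comb_eval_cons /= !scalerDr !scalerA -!intrM.
  by rewrite addrCA.
Qed.

Lemma comb_eval_collect v : ev (collect v) = ev v.
Proof.
elim: v => // x v IH.
have -> : collect (x :: v) = lincomb 1 [:: x] 1 (collect v) by [].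
by rewrite comb_eval_lincomb IH comb_eval_cons comb_eval_cons comb_eval_nil addr0 !scale1r.
Qed.

Definition subspace (Q : W -> Prop) := Q 0 /\ forall c x y, Q x -> Q y -> Q (c *: x + y).

Variables (Q : W -> Prop) (sQ : subspace Q).

Lemma subspaceZ c x : Q x -> Q (c *: x).
Proof. by case: sQ => Q0 Ql Qx; rewrite -[_ *: _]addr0; apply: Ql. Qed.

Lemma subspace_scaleK c x : c != 0 -> Q (c *: x) -> Q x.
Proof. by move=> c0 /(subspaceZ c^-1); rewrite scalerA mulVf // scale1r. Qed.

Lemma intr_char0_eq0 (m : int) : (m%:~R == 0 :> F) = (m == 0).
Proof.
have n0 (n : nat) : (n%:R == 0 :> F) = (n == 0)%N.
  exact: (pcharf0P F).1.
by case: m => n; rewrite ?NegzE ?mulrNz ?oppr_eq0 [_%:~R == 0]n0.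
Qed.

(** Elimination only forms linear combinations. Testing against an arbitrary subspace [Q] replaces
    explicit bookkeeping of coefficients; together with [subspace_insert_inv] it says that spans are
    preserved. *)
Lemma subspace_insert rows v :
  (forall r, r \in rows -> Q (ev r)) -> Q (ev v) -> forall r, r \in insert rows v -> Q (ev r).
Proof.
case: sQ => Q0 Ql.
elim: rows v => [|r rows IH] [|x v] // Hr Hv s; first by rewrite inE => /eqP ->.
have {}IH w : Q (ev w) -> s \in r :: insert rows w -> Q (ev s).
  move=> Hw; rewrite inE => /predU1P[->|]; first by apply: Hr; rewrite mem_head.
  by apply: IH => // t tr; apply: Hr; rewrite inE tr orbT.
case: r Hr IH => [|y r] Hr IH; first exact: IH.
rewrite insert_cons; case: (lexcmp _ _).
- apply: IH; case: eqP => // _; rewrite comb_eval_lincomb.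
  by apply: Ql; [|apply/subspaceZ/Hr/mem_head].
- by rewrite inE => /predU1P[->//|]; exact: Hr.
- exact: IH.
Qed.

Lemma subspace_insert_inv rows v :
  (forall r, r \in insert rows v -> Q (ev r)) -> Q (ev v) /\ forall r, r \in rows -> Q (ev r).
Proof.
case: sQ => Q0 Ql.
elim: rows v => [|r rows IH] [|x v] Hr; do ?[by split; rewrite ?comb_eval_nil].
  by split=> //; apply: Hr; rewrite mem_head.
have {}IH w : (forall s, s \in r :: insert rows w -> Q (ev s)) ->
    Q (ev w) /\ forall s, s \in r :: rows -> Q (ev s).
  move=> H; have [|Hw Hs] := IH w; first by move=> s si; apply: H; rewrite inE si orbT.
  split=> // s; rewrite inE => /predU1P[->|]; last exact: Hs.
  by apply: H; rewrite mem_head.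
case: r Hr IH => [|y r] Hr IH; first exact: IH.
move: Hr; rewrite insert_cons; case: (lexcmp _ _) => Hr.
(* At a zero pivot coefficient [insert] passes [v] on unchanged. *)
- case: eqP Hr => [_|/eqP y0] Hr; first exact: IH.
  have [Qc Hs] := IH _ Hr; split=> //.
  (* The reduced row is [y.2] times [x :: v] minus [x.2] times [y :: r]; adding the second multiple
     back leaves [y.2] times [x :: v], and [y.2] is invertible in characteristic 0. *)
  have {Qc} : Q (y.2%:~R *: ev (x :: v)).
    move: Qc; rewrite comb_eval_lincomb => Qc.
    have Qr := Hs _ (mem_head _ _).
    by have := Ql x.2%:~R _ _ Qr Qc; rewrite addrCA rmorphN scaleNr subrr addr0.
  by apply: subspace_scaleK; rewrite intr_char0_eq0.
- by split=> [|s si]; apply: Hr; rewrite ?mem_head // inE si orbT.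
- exact: IH.
Qed.

Lemma subspace_gauss rows vs :
  (forall r, r \in rows -> Q (ev r)) -> (forall v, v \in vs -> Q (ev v)) ->
  forall r, r \in gauss rows vs -> Q (ev r).
Proof.
elim: vs rows => //= v vs IH rows Hr Hv; apply: IH => [|w wv]; last first.
  by apply: Hv; rewrite inE wv orbT.
by apply: subspace_insert => //; apply: Hv; rewrite mem_head.
Qed.

Lemma subspace_gauss_inv rows vs :
  (forall r, r \in gauss rows vs -> Q (ev r)) ->
  (forall r, r \in rows -> Q (ev r)) /\ (forall v, v \in vs -> Q (ev v)).
Proof.
elim: vs rows => //= v vs IH rows /IH[/subspace_insert_inv[Hv Hr] Hvs]; split=> // w.
by rewrite inE => /predU1P[->|/Hvs].
Qed.

End Gauss.

(** * Linear independence of echelon rows modulo a subspace *)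

Section Span.
Variables (F : fieldType) (W : lmodType F) (P : W -> Prop) (sP : subspace P).

(** The sum of [P] and the linear span of [rs], with the coefficients as nested existentials so that
    they can be peeled off one row at a time. *)
Fixpoint span_mod (rs : seq W) (x : W) : Prop :=
  if rs is r :: rs' then exists d : F, span_mod rs' (x - d *: r) else P x.

Lemma span_mod_subspace rs : subspace (span_mod rs).
Proof.
elim: rs => [|r rs [IH0 IHl]] //=; split; first by exists 0; rewrite scale0r subr0.
move=> c x y [d dx] [e ey]; exists (c * d + e).
rewrite scalerDl -scalerA opprD addrACA -scalerBr; exact: IHl.
Qed.

Lemma span_mod_base rs x : P x -> span_mod rs x.
Proof. by elim: rs x => //= r rs IH x Px; exists 0; rewrite scale0r subr0; exact: IH. Qed.

Lemma span_mod_mem rs r : r \in rs -> span_mod rs r.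
Proof.
elim: rs => // r' rs IH; rewrite inE => /predU1P[->|/IH rsr] /=.
  by exists 1; rewrite scale1r subrr; case: (span_mod_subspace rs).
by exists 0; rewrite scale0r subr0.
Qed.

Lemma span_mod_sub (Q : W -> Prop) rs x : subspace Q ->
  (forall y, P y -> Q y) -> (forall r, r \in rs -> Q r) -> span_mod rs x -> Q x.
Proof.
move=> sQ PQ; elim: rs x => [|r rs IH] x Qr /=; first exact: PQ.
case=> d /IH Qx; rewrite -[x](subrK (d *: r)) addrC.
by apply: sQ.2; [apply/Qr/mem_head | apply: Qx => s si; apply: Qr; rewrite inE si orbT].
Qed.

End Span.

Definition pivot (r : comb (seq nat)) : seq nat := if r is x :: _ then x.1 else [::].

Definition echelon (rows : seq (comb (seq nat))) : bool :=
  sorted lexlt (map pivot rows) &&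
  all (fun r => if r is x :: r' then (x.2 != 0) && path lexlt x.1 (map fst r') else false) rows.

Section Echelon.
Variables (F : fieldType) (charF0 : [pchar F] =i pred0) (W : lmodType F).
Variables (val : seq nat -> W) (coord : seq nat -> W -> F^o).
Local Notation ev := (comb_eval val).
Hypothesis coord_linear : forall k, linear (coord k).

Lemma coord_notin k (r : comb (seq nat)) :
  (forall j, coord k (val j) = (j == k)%:R) -> k \notin map fst r -> coord k (ev r) = 0.
Proof.
move=> ck; rewrite (linear_comb_eval val r (coord_linear k)) /comb_eval => kr.
rewrite big_seq big1 // => x xr; rewrite /= ck; case: eqP => [e|_]; last by rewrite scaler0.
by case/negP: kr; rewrite -e; apply/mapP; exists x.
Qed.

(** The pivot of the first row occurs in no later row, and its coordinate vanishes on [P] and on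
    [x]; so the coefficient of the first row in [x] is 0, and induction removes the other rows. *)
Lemma echelon_independent (P : W -> Prop) rows x : subspace P -> echelon rows ->
  (forall r k, r \in rows -> k = pivot r -> forall j, coord k (val j) = (j == k)%:R) ->
  (forall k y, P y -> coord k y = 0) -> (forall k, coord k x = 0) ->
  span_mod P (map ev rows) x -> P x.
Proof.
move=> sP ech cE Pc; elim: rows ech x cE => //= r rows IH.
rewrite /echelon /= => /and3P[rp rr rs] x cE xc [d dx].
have ech : echelon rows by rewrite /echelon (path_sorted rp).
have c0 k : subspace (fun y => coord k y = 0).
  split; first exact: linear_fun0 (coord_linear k).
  by move=> c y z yk zk; rewrite coord_linear yk zk scaler0 addr0.
suff d0 : d = 0.
  apply: (IH ech) => // [r' k r'r|]; first by apply: cE; rewrite inE r'r orbT.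
  by move: dx; rewrite d0 scale0r subr0.
have ck := cE r _ (mem_head _ _) erefl.
have : coord (pivot r) (x - d *: ev r) = 0.
  apply: span_mod_sub (c0 (pivot r)) _ _ dx => [y|_ /mapP[s srows ->]]; first exact: Pc.
  (* Keys increase along a row and pivots increase along the rows, so the pivot of [r] cannot occur
     in the later row [s]. *)
  apply: coord_notin => //; apply/negP => ks.
  have rs' : lexlt (pivot r) (pivot s).
    by apply: (allP (order_path_min lexlt_trans rp)); apply: map_f.
  move: (allP rs s srows); case: s {srows} ks rs' => // y s ks rs' /andP[_ sp].
  move: ks; rewrite inE => /predU1P[e|ks].
    by move: rs'; rewrite /= -e lexlt_irr.
  have := allP (order_path_min lexlt_trans sp) _ ks.
  by move/(lexlt_trans rs'); rewrite lexlt_irr.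
rewrite (linear_subr (coord_linear _)) xc sub0r => /eqP; rewrite oppr_eq0.
case: r rp rr ck {dx cE} => // y r rp /andP[y0 pr] ck.
rewrite -[_ *: _]addr0 coord_linear (linear_fun0 (coord_linear _)) addr0.
rewrite comb_eval_cons coord_linear ck eqxx coord_notin //; last first.
  by apply/negP => /(allP (order_path_min lexlt_trans pr)); rewrite lexlt_irr.
rewrite addr0 !scaler_eq0 (intr_char0_eq0 charF0) (negPf y0) oner_eq0 !orbF.
exact: eqP.
Qed.

End Echelon.

(** * A dendriform algebra on words *)

Lemma fglift_linear_param (F : fieldType) (K : choiceType) (V W : lmodType F)
    (f : V -> K -> W) (u : {freeg K / F}) :
  (forall k, linear (f^~ k)) -> linear (fun v => fglift (f v) u).
Proof.
move=> fl c v w; rewrite -[u]freeg_sumE !linear_sum -big_split /=.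
by apply: eq_bigr => k _; rewrite !liftU fl scalerDr !scalerA mulrC.
Qed.

Section MultilinearFreeg.
Variables (F : fieldType) (K : choiceType) (W : lmodType F).
Implicit Types u v w : {freeg K / F}.

Lemma trilinear_freeg_ext (g h : {freeg K / F} -> {freeg K / F} -> {freeg K / F} -> W) :
  (forall v w, linear (fun u => g u v w)) -> (forall u w, linear (fun v => g u v w)) ->
  (forall u v, linear (g u v)) ->
  (forall v w, linear (fun u => h u v w)) -> (forall u w, linear (fun v => h u v w)) ->
  (forall u v, linear (h u v)) ->
  (forall x y z, g << x >> << y >> << z >> = h << x >> << y >> << z >>) ->
  forall u v w, g u v w = h u v w.
Proof.
move=> g1 g2 g3 h1 h2 h3 e u v w.
apply: (freeg_linear_ext (g1 v w) (h1 v w)) => x.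
apply: (freeg_linear_ext (g2 _ w) (h2 _ w)) => y.
by apply: (freeg_linear_ext (g3 _ _) (h3 _ _)) => z; exact: e.
Qed.

Definition fglift3 (f : K -> K -> K -> W) u v w : W :=
  fglift (fun r => fglift (fun s => fglift (f r s) w) v) u.

Lemma fglift3_linear1 f v w : linear (fun u => fglift3 f u v w).
Proof. by move=> c u u'; rewrite /fglift3 linearP. Qed.

Lemma fglift3_linear2 f u w : linear (fun v => fglift3 f u v w).
Proof. by apply: fglift_linear_param => k c v v'; rewrite linearP. Qed.

Lemma fglift3_linear3 f u v : linear (fglift3 f u v).
Proof. by do 2!apply: fglift_linear_param => ?; move=> c w w'; rewrite linearP. Qed.

End MultilinearFreeg.

(* The letters are 0, ..., 4; the value at the empty word is 5. *)
Definition minletter (w : seq nat) : nat := foldr minn 5 w.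

Lemma minletter_cat x y : minletter (x ++ y) = minn (minletter x) (minletter y).
Proof.
have le5 w : (minletter w <= 5)%N by elim: w => //= m w IH; rewrite geq_min IH orbT.
elim: x => [|m x IH] /=; first by move: (le5 y); rewrite /minletter /=; lia.
by rewrite -/(minletter _) IH minnA.
Qed.

Section Words.
Variable F : fieldType.

Definition word_algebra : Type := {freeg (seq nat) / F}.
HB.instance Definition _ := GRing.Lmodule.on word_algebra.
Implicit Types u v w : word_algebra.

Definition word (x : seq nat) : word_algebra := << x >>.

(** With the condition kept as a boolean, each dendriform axiom on words becomes a propositional
    statement about minima, which [lia] decides. *)
Definition cond_word (b : bool) (x : seq nat) : word_algebra := if b then word x else 0.

Lemma wordE x : word x = cond_word true x. Proof. by []. Qed.

Lemma cond_word_split b c x : ~~ (b && c) ->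
  cond_word (b || c) x = cond_word b x + cond_word c x.
Proof. by case: b; case: c; rewrite //= ?addr0 ?add0r. Qed.

Definition restricted_cat (r : rel nat) u v : word_algebra :=
  fglift (fun x => fglift (fun y =>
    cond_word (r (minletter x) (minletter y)) (x ++ y)) v) u.

Lemma restricted_cat_linearl r v : linear (restricted_cat r ^~ v).
Proof. by move=> c u w; rewrite /restricted_cat linearP. Qed.

Lemma restricted_cat_linearr r u : linear (restricted_cat r u).
Proof. by apply: fglift_linear_param => k c v w; rewrite linearP. Qed.

Lemma restricted_cat_word r x y :
  restricted_cat r (word x) (word y) = cond_word (r (minletter x) (minletter y)) (x ++ y).
Proof. by rewrite /restricted_cat !fgliftU1. Qed.

Lemma restricted_cat_cond r b x c y :
  restricted_cat r (cond_word b x) (cond_word c y) =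
  cond_word [&& b, c & r (minletter x) (minletter y)] (x ++ y).
Proof.
case: b => /=; last exact: linear_fun0 (restricted_cat_linearl _ _).
case: c => /=; last exact: linear_fun0 (restricted_cat_linearr _ _).
exact: restricted_cat_word.
Qed.

Local Notation prec := (restricted_cat ltn).
Local Notation succ := (restricted_cat geq).

Let ll := restricted_cat_linearl.
Let lr := restricted_cat_linearr.

(** On words, both sides are [xyz] exactly when [min y <= min x] and [min y < min z]. *)
Lemma word_succ_prec u v w : prec (succ u v) w = succ u (prec v w).
Proof.
move: u v w; apply: trilinear_freeg_ext; try by [move=> ? ? c ? ?; rewrite !(ll, lr)].
move=> x y z; rewrite -!/(word _) !(wordE x, wordE y, wordE z).
rewrite !restricted_cat_cond !minletter_cat catA.
by congr cond_word; lia.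
Qed.

(** On words, the left side asks for [min x < min y] and [min x < min z]; the two terms on the right
    split this into the disjoint cases [min y < min z] and [min z <= min y]. *)
Lemma word_prec_prec u v w : prec (prec u v) w = prec u (prec v w) + prec u (succ v w).
Proof.
move: u v w; apply: trilinear_freeg_ext;
  try by [move=> ? ? c ? ?; rewrite !(ll, lr) ?scalerDr 1?addrACA].
move=> x y z; rewrite -!/(word _) !(wordE x, wordE y, wordE z).
rewrite !restricted_cat_cond !minletter_cat !catA.
rewrite -cond_word_split; last by lia.
by congr cond_word; lia.
Qed.

(** The same argument, with [min z] at most the other two minima and the cases [min y <= min x] and
    [min x < min y]. *)
Lemma word_succ_succ u v w : succ u (succ v w) = succ (succ u v) w + succ (prec u v) w.
Proof.
move: u v w; apply: trilinear_freeg_ext;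
  try by [move=> ? ? c ? ?; rewrite !(ll, lr) ?scalerDr 1?addrACA].
move=> x y z; rewrite -!/(word _) !(wordE x, wordE y, wordE z).
rewrite !restricted_cat_cond !minletter_cat !catA.
rewrite -cond_word_split; last by lia.
by congr cond_word; lia.
Qed.

HB.instance Definition _ := Lmodule_isDendriform.Build F word_algebra
  (ll ltn) (lr ltn) (ll geq) (lr geq) word_succ_prec word_prec_prec word_succ_succ.

End Words.

(** * Evaluation of the triple products *)

Section TripleEval.
Variables (F : fieldType) (D : dendriformType F).

Fixpoint triple_eval (X : Type) (f : X -> D) (t : ttree X) : D :=
  match t with
  | TLeaf i => f i
  | TOne t1 t2 t3 => prelie1 (triple_eval f t1) (triple_eval f t2) (triple_eval f t3)
  | TTwo t1 t2 t3 => prelie2 (triple_eval f t1) (triple_eval f t2) (triple_eval f t3)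
  end.

Lemma triple_eval_tmap (X Y : Type) (f : Y -> D) (g : X -> Y) t :
  triple_eval f (tmap g t) = triple_eval (f \o g) t.
Proof. by elim: t => //= t1 -> t2 -> t3 ->. Qed.

(** Dendriform morphisms commute with the triple products, so evaluation in any dendriform algebra
    factors through [expand] and therefore vanishes on its kernel. *)
Lemma fd_lift_expand n (f : 'I_n -> D) (u : triple_free F n) :
  fd_lift f (expand u) = fglift (triple_eval f) u.
Proof.
have [[lL lp ls lg] _] := free_dend_universal f.
have lB : {morph fd_lift f : x y / prelie x y}.
  by move=> x y; rewrite /prelie (linear_subr lL) lp ls.
move: u; apply: freeg_linear_ext => [c u v|c u v|t]; do ?by rewrite /expand linearP ?lL.
rewrite /expand !fgliftU1; elim: t => [i|t1 IH1 t2 IH2 t3 IH3|t1 IH1 t2 IH2 t3 IH3] /=.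
- exact: lg.
- by rewrite /prelie1 !lB IH1 IH2 IH3.
- by rewrite /prelie2 !lB IH1 IH2 IH3.
Qed.

Lemma triple_eval_Sn_act n (f : 'I_n -> D) (s : 'S_n) (u : triple_free F n) :
  fglift (triple_eval f) (Sn_act s u) = fglift (triple_eval (f \o s)) u.
Proof.
move: u; apply: freeg_linear_ext => [c u v|c u v|t]; do ?by rewrite /Sn_act !linearP.
by rewrite /Sn_act !fgliftU1 triple_eval_tmap.
Qed.

Lemma prelie_linearl y : linear (fun x : D => prelie x y).
Proof.
move=> c x z; rewrite /prelie dprec_linearl dsucc_linearr opprD addrACA.
by rewrite scalerBr.
Qed.

Lemma prelie_linearr x : linear (prelie x : D -> D).
Proof.
move=> c y z; rewrite /prelie dprec_linearr dsucc_linearl opprD addrACA.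
by rewrite scalerBr.
Qed.

End TripleEval.

(** Both terms require the minimum to be attained in [x], because [y ≻ x] applies [geq] to the
    swapped arguments; for equal minima only [- yx] remains. *)
Definition word_prelie (x y : seq nat) : comb (seq nat) :=
  (if (minletter x < minletter y)%N then [:: (x ++ y, 1)] else [::]) ++
  (if (minletter x <= minletter y)%N then [:: (y ++ x, -1)] else [::]).

Fixpoint tree_words (f : nat -> nat) (t : ttree nat) : comb (seq nat) :=
  match t with
  | TLeaf i => [:: ([:: f i], 1)]
  | TOne t1 t2 t3 =>
    bilin_comb word_prelie
      (bilin_comb word_prelie (tree_words f t1) (tree_words f t2)) (tree_words f t3)
  | TTwo t1 t2 t3 =>
    bilin_comb word_prelie
      (tree_words f t1) (bilin_comb word_prelie (tree_words f t2) (tree_words f t3))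
  end.

Fixpoint leftmost (X : Type) (t : ttree X) : X :=
  match t with
  | TLeaf i => i
  | TOne t1 _ _ | TTwo t1 _ _ => leftmost t1
  end.

Lemma leftmost_tmap (X Y : Type) (f : X -> Y) t : leftmost (tmap f t) = f (leftmost t).
Proof. by elim: t. Qed.

Lemma tmap_comp (X Y Z : Type) (f : Y -> Z) (g : X -> Y) t :
  tmap f (tmap g t) = tmap (f \o g) t.
Proof. by elim: t => //= t1 -> t2 -> t3 ->. Qed.

Lemma eq_in_tmap (X : eqType) (Y : Type) (f g : X -> Y) t :
  {in tleaves t, f =1 g} -> tmap f t = tmap g t.
Proof.
elim: t => [i|t1 IH1 t2 IH2 t3 IH3|t1 IH1 t2 IH2 t3 IH3] /= e;
  do ?[rewrite IH1 ?IH2 ?IH3 // => i it; apply: e; rewrite !mem_cat it ?orbT //].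
by rewrite e ?mem_head.
Qed.

Lemma tleaves_tmap (X Y : Type) (f : X -> Y) t : tleaves (tmap f t) = map f (tleaves t).
Proof. by elim: t => //= t1 -> t2 -> t3 ->; rewrite !map_cat. Qed.

Section WordModel.
Variable F : fieldType.
Local Notation wev := (comb_eval (@word F)).

Lemma comb_eval_word_prelie x y :
  wev (word_prelie x y) = prelie (word F x) (word F y).
Proof.
rewrite /prelie [_ ≺ _]restricted_cat_word [_ ≻ _]restricted_cat_word comb_eval_cat.
rewrite /cond_word /=; congr (_ + _); case: ifP; rewrite ?comb_eval_nil ?oppr0 ?comb_eval1 //.
by rewrite comb_eval_cons comb_eval_nil addr0 /= rmorphN scaleN1r.
Qed.

Lemma comb_eval_tree_words (f : nat -> nat) t :
  wev (tree_words f t) = triple_eval (fun i => word F [:: f i]) t.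
Proof.
have B l1 l2 : wev (bilin_comb word_prelie l1 l2) = prelie (wev l1) (wev l2).
  apply: (comb_eval_bilin (val1 := @word F) (val2 := @word F)).
  - exact: prelie_linearl.
  - exact: prelie_linearr.
  - exact: comb_eval_word_prelie.
elim: t => [i|t1 IH1 t2 IH2 t3 IH3|t1 IH1 t2 IH2 t3 IH3] /=.
- by rewrite comb_eval1.
- by rewrite !B IH1 IH2 IH3.
- by rewrite !B IH1 IH2 IH3.
Qed.

(** A product of words survives only if its left factor has the smaller or equal minimum, so the
    minimum is inherited from the leftmost leaf. The bound on [f] keeps a single letter from being
    cut off at 5, the value at the empty word. *)
Lemma minletter_tree_words (f : nat -> nat) t w :
  (forall i, f i <= 5)%N -> w \in map fst (tree_words f t) -> minletter w = f (leftmost t).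
Proof.
move=> f5.
(* The minimum of a product is that of its left factor, whatever the right factor is. *)
have B l1 l2 m : (forall w, w \in map fst l1 -> minletter w = m) ->
    forall w, w \in map fst (bilin_comb word_prelie l1 l2) -> minletter w = m.
  move=> H _ /mapP[_ /flattenP[_ /allpairsP[[x y] [xl yl ->]] /mapP[z zxy ->]] ->] /=.
  have {xl} <- := H _ (map_f fst xl).
  move: zxy; rewrite /word_prelie mem_cat; case/orP; case: ifP => //= lexy;
  rewrite inE => /eqP -> /=; rewrite minletter_cat; lia.
elim: t w => [i|t1 IH1 t2 IH2 t3 IH3|t1 IH1 t2 IH2 t3 IH3] w /=.
- by rewrite inE => /eqP -> /=; have := f5 i; rewrite /minletter /=; lia.
- by apply: (B) => {}w; apply: (B) => {}w /IH1.
- by apply: (B) => {}w /IH1.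
Qed.

End WordModel.

(** * Monomials with numeric leaves, and the generators as explicit lists *)

Section TreeEval.
Variable F : fieldType.

(** Computations use leaves in [nat], free of the proofs inside ['I_5]; [inord] restores the
    variables. *)
Definition tree_vec (t : ttree nat) : triple_free F 5 := << tmap inord t >>.
Local Notation tev := (comb_eval tree_vec).

Lemma comb_eval_top1 l1 l2 l3 :
  tev (trilin_comb (@TOne nat) l1 l2 l3) = top1 (tev l1) (tev l2) (tev l3).
Proof.
apply: comb_eval_trilin => [v w|u w|u v|x y z].
- exact: fglift3_linear1.
- exact: fglift3_linear2.
- exact: fglift3_linear3.
- by rewrite /top1 !fgliftU1.
Qed.

Lemma comb_eval_top2 l1 l2 l3 :
  tev (trilin_comb (@TTwo nat) l1 l2 l3) = top2 (tev l1) (tev l2) (tev l3).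
Proof.
apply: comb_eval_trilin => [v w|u w|u v|x y z].
- exact: fglift3_linear1.
- exact: fglift3_linear2.
- exact: fglift3_linear3.
- by rewrite /top2 !fgliftU1.
Qed.

Lemma comb_eval_tvar i : tev [:: (TLeaf i, 1)] = tvar F (inord i).
Proof. by rewrite comb_eval1. Qed.

End TreeEval.

(* The list of monomials is assembled by unification, and computed from the proof. *)
Lemma generators_spec : {gs : seq (comb (ttree nat)) | forall F : fieldType,
  let a := tvar F (@Ordinal 5 0 isT) in
  let b := tvar F (@Ordinal 5 1 isT) in
  let c := tvar F (@Ordinal 5 2 isT) in
  let d := tvar F (@Ordinal 5 3 isT) in
  let e := tvar F (@Ordinal 5 4 isT) in
  TRS_liftings a b c d e ++
    [:: identity1 a b c d e; identity2 a b c d e; identity3 a b c d e] =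
  map (comb_eval (@tree_vec F)) gs}.
Proof.
eexists => F /=.
have inordE i (lti : (i < 5)%N) : Ordinal lti = inord i by apply: val_inj; rewrite /= inordK.
rewrite !inordE -!comb_eval_tvar /identity1 /identity2 /identity3 /TRS.
rewrite -!(comb_eval_top1, comb_eval_top2, comb_eval_sub, comb_eval_cat).
have nilE : [::] = map (comb_eval (@tree_vec F)) [::] by [].
rewrite nilE -!map_cons; reflexivity.
Defined.

Definition generators : seq (comb (ttree nat)) := Eval vm_compute in sval generators_spec.

Definition generator_vecs (F : fieldType) : seq (triple_free F 5) :=
  map (comb_eval (@tree_vec F)) generators.

Lemma generatorsE (F : fieldType) :
  let a := tvar F (@Ordinal 5 0 isT) in
  let b := tvar F (@Ordinal 5 1 isT) in
  let c := tvar F (@Ordinal 5 2 isT) in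
  let d := tvar F (@Ordinal 5 3 isT) in
  let e := tvar F (@Ordinal 5 4 isT) in
  TRS_liftings a b c d e ++
    [:: identity1 a b c d e; identity2 a b c d e; identity3 a b c d e] =
  generator_vecs F.
Proof. exact: (svalP generators_spec). Qed.

(** * Rank computation *)

Definition rooted_perms : seq (seq nat) := [seq 0%N :: p | p <- permutations (iota 1 4)].

Definition tnode (X : Type) (b : bool) : ttree X -> ttree X -> ttree X -> ttree X :=
  if b then @TOne X else @TTwo X.

(** [f] selects the outer operation, [g] the inner one, and [k] the argument holding the inner
    product: 12 shapes, which the 24 words of [rooted_perms] turn into 288 monomials. *)
Definition fill (shape : bool * bool * nat) (p : seq nat) : ttree nat :=
  let: (f, g, k) := shape in
  let x i := TLeaf (nth 0%N p i) in
  match k with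
  | 0 => tnode f (tnode g (x 0) (x 1) (x 2)) (x 3) (x 4)
  | 1 => tnode f (x 0) (tnode g (x 1) (x 2) (x 3)) (x 4)
  | _ => tnode f (x 0) (x 1) (tnode g (x 2) (x 3) (x 4))
  end%N.

Definition shapes : seq (bool * bool * nat) :=
  [seq (fg, k) | fg <- [seq (f, g) | f <- [:: true; false], g <- [:: true; false]],
                 k <- iota 0 3].

Definition rooted_trees : seq (ttree nat) :=
  [seq fill shape p | shape <- shapes, p <- rooted_perms].

(** * Classification of the monomials of degree 5 by parity of the number of leaves *)

Lemma odd_tleaves (X : Type) (t : ttree X) : odd (size (tleaves t)).
Proof.
by elim: t => //= t1 IH1 t2 IH2 t3 IH3; rewrite !size_cat !oddD IH1 IH2 IH3.
Qed.

Lemma tree_cases (X : Type) (t : ttree X) :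
  (exists i, t = TLeaf i) \/ (exists b t1 t2 t3, t = tnode b t1 t2 t3).
Proof.
case: t => [i|t1 t2 t3|t1 t2 t3]; [by left; exists i|right..].
  by exists true, t1, t2, t3.
by exists false, t1, t2, t3.
Qed.

Lemma tleaves_tnode (X : Type) b (t1 t2 t3 : ttree X) :
  tleaves (tnode b t1 t2 t3) = tleaves t1 ++ tleaves t2 ++ tleaves t3.
Proof. by case: b. Qed.

Lemma size1_tleaves (X : Type) (t : ttree X) : size (tleaves t) = 1%N -> exists i, t = TLeaf i.
Proof.
case: (tree_cases t) => [[i ->] _|[b [t1 [t2 [t3 ->]]]]]; first by exists i.
rewrite tleaves_tnode !size_cat.
by move: (odd_tleaves t1) (odd_tleaves t2) (odd_tleaves t3); lia.
Qed.

Lemma size3_tleaves (X : Type) (t : ttree X) : size (tleaves t) = 3 ->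
  exists b i j k, t = tnode b (TLeaf i) (TLeaf j) (TLeaf k).
Proof.
case: (tree_cases t) => [[i ->] //|[b [t1 [t2 [t3 ->]]]]]; rewrite tleaves_tnode !size_cat.
move: (odd_tleaves t1) (odd_tleaves t2) (odd_tleaves t3) => o1 o2 o3 s3.
have [i ->] : exists i, t1 = TLeaf i by apply: size1_tleaves; lia.
have [j ->] : exists i, t2 = TLeaf i by apply: size1_tleaves; lia.
have [k ->] : exists i, t3 = TLeaf i by apply: size1_tleaves; lia.
by exists b, i, j, k.
Qed.

(** Three odd numbers with sum 5 are 3, 1, 1 in some order, so exactly one argument of the outer
    operation is itself a product, and it has three leaves. *)
Lemma mem_rooted_trees t :
  perm_eq (tleaves t) (iota 0 5) -> leftmost t = 0%N -> t \in rooted_trees.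
Proof.
move=> pt lt; suff [shape ssh e] : exists2 shape, shape \in shapes & t = fill shape (tleaves t).
  rewrite e; apply: allpairs_f => //.
  have [q lq] : exists q, tleaves t = 0%N :: q.
    rewrite -lt; elim: t {pt lt e} => [i|t1 [q q1] t2 _ t3 _|t1 [q q1] t2 _ t3 _];
      rewrite /= ?q1; by eexists.
  rewrite lq /rooted_perms map_f // mem_permutations.
  by move: pt; rewrite lq -[iota 0 5]/(0%N :: iota 1 4) perm_cons.
have := perm_size pt; case: (tree_cases t) => [[i ->] //|[f [t1 [t2 [t3 ->]]]]].
rewrite tleaves_tnode !size_cat [RHS]/= {pt lt}.
move: (odd_tleaves t1) (odd_tleaves t2) (odd_tleaves t3) => o1 o2 o3 s5.
have [s1|s1] := eqVneq (size (tleaves t1)) 3.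
  have [g [i [j [k ->]]]] := size3_tleaves s1.
  have [m ->] : exists i, t2 = TLeaf i by apply: size1_tleaves; lia.
  have [n ->] : exists i, t3 = TLeaf i by apply: size1_tleaves; lia.
  by exists (f, g, 0%N); case: f; case: g.
have [m ->] : exists i, t1 = TLeaf i by apply: size1_tleaves; lia.
have [s2|s2] := eqVneq (size (tleaves t2)) 3.
  have [g [i [j [k ->]]]] := size3_tleaves s2.
  have [n ->] : exists i, t3 = TLeaf i by apply: size1_tleaves; lia.
  by exists (f, g, 1%N); case: f; case: g.
have [n ->] : exists i, t2 = TLeaf i by apply: size1_tleaves; lia.
have [g [i [j [k ->]]]] : exists b i j k, t3 = tnode b (TLeaf i) (TLeaf j) (TLeaf k).
  by apply: size3_tleaves; lia.
by exists (f, g, 2%N); case: f; case: g.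
Qed.

(* Any order of the keys would do; with [TTwo] below and [TOne] above the leaves, the
   coefficients met during elimination stay in {-1, 0, 1}. *)
Fixpoint encode (t : ttree nat) : seq nat :=
  match t with
  | TLeaf i => [:: i.+1]
  | TOne t1 t2 t3 => 9 :: encode t1 ++ encode t2 ++ encode t3
  | TTwo t1 t2 t3 => 0%N :: encode t1 ++ encode t2 ++ encode t3
  end.

(** Keys are in prefix notation and are read from the right with a stack. Leaves below 5 have the
    codes 1 to 5, distinct from the codes 0 and 9 of the operations. *)
Definition decode_step (k : nat) (ts : seq (ttree nat)) : seq (ttree nat) :=
  match k, ts with
  | 9, t1 :: t2 :: t3 :: ts' => TOne t1 t2 t3 :: ts'
  | 0%N, t1 :: t2 :: t3 :: ts' => TTwo t1 t2 t3 :: ts'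
  | _, _ => TLeaf k.-1 :: ts
  end.

Definition decode (s : seq nat) : ttree nat := head (TLeaf 0%N) (foldr decode_step [::] s).

Lemma encodeK t : all (ltn^~ 5) (tleaves t) -> decode (encode t) = t.
Proof.
move=> t5; suff dec s : foldr decode_step [::] (encode t ++ s) = t :: foldr decode_step [::] s.
  by rewrite /decode -[encode t]cats0 dec.
elim: t s t5 => [i|t1 IH1 t2 IH2 t3 IH3|t1 IH1 t2 IH2 t3 IH3] s /=.
- by do 5?[case: i => [|i] //].
- by rewrite !all_cat => /and3P[l1 l2 l3]; rewrite -!catA IH1 // IH2 // IH3.
- by rewrite !all_cat => /and3P[l1 l2 l3]; rewrite -!catA IH1 // IH2 // IH3.
Qed.

(* Keys starting with 0 are coordinates in the word algebras, keys starting with 1 are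
   monomials: the row of [t] is the pair of the image of [t] and [t] itself. *)
Definition tree_row (t : ttree nat) : comb (seq nat) :=
  collect (flatten [seq [seq (0%N :: p ++ w.1, w.2)
                        | w <- tree_words (nth 0%N p) t & head 1%N w.1 == 0%N]
                   | p <- rooted_perms] ++ [:: (1%N :: encode t, 1)]).

Definition relabel (p : seq nat) (l : comb (ttree nat)) : comb (ttree nat) :=
  [seq (tmap (nth 0%N p) x.1, x.2) | x <- l].

(** All monomials of a generator share their leftmost variable, so the first one decides whether a
    relabelled copy is supported on the rooted monomials. *)
Definition relabeled_generators : seq (comb (ttree nat)) :=
  [seq l <- [seq relabel p l | l <- generators, p <- permutations (iota 0 5)]
   | if l is x :: _ then leftmost x.1 == 0%N else false].

Definition encode_comb (l : comb (ttree nat)) : comb (seq nat) :=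
  collect [seq (1%N :: encode x.1, x.2) | x <- l].

Definition word_pivot (r : comb (seq nat)) : bool := head 1%N (pivot r) == 0%N.

(* The rows with a monomial as pivot have no word coordinates, hence span the kernel;
   they must reduce to 0 modulo the generators. *)
Definition kernel_spanned (trees : seq (ttree nat)) (gens : seq (comb (ttree nat))) : bool :=
  let rows := gauss [::] (map tree_row trees) in
  let gen_rows := gauss [::] (map encode_comb gens) in
  echelon (filter word_pivot rows) &&
  (gauss gen_rows (filter (predC word_pivot) rows) == gen_rows).

Lemma kernel_spanned_generators : kernel_spanned rooted_trees relabeled_generators.
Proof. by vm_compute. Qed.

Lemma perm_eq_leaves_generators :
  all (fun l => all (fun x => perm_eq (tleaves x.1) (iota 0 5)) l) generators.
Proof. by vm_compute. Qed.

(** * The functionals separating the rooted monomials modulo the kernel *)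

Section WordVector.
Variable F : fieldType.
Local Notation V := (word_algebra F).

(** The default 1 discards the empty word. The prefix [p], of length 5 for every [p] in
    [rooted_perms], keeps the coordinates of different substitutions apart, so [word_vec] packs all
    functionals into one vector. *)
Definition rooted_word (p w : seq nat) : V := cond_word F (head 1%N w == 0%N) (p ++ w).

Definition letter_word (p : seq nat) (i : nat) : V := word F [:: nth 0%N p i].

Definition word_vec (u : triple_free F 5) : V :=
  \sum_(p <- rooted_perms)
    fglift (rooted_word p) (fglift (triple_eval (letter_word p \o val)) u).

Lemma word_vec_linear : linear word_vec.
Proof.
move=> c u v; rewrite /word_vec scaler_sumr -big_split /=; apply: eq_bigr => p _.
by rewrite !linearP.
Qed.

Lemma word_vec_tree (t : ttree 'I_5) : word_vec << t >> =
  \sum_(p <- rooted_perms)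
    comb_eval (rooted_word p) (tree_words (nth 0%N p) (tmap val t)).
Proof.
apply: eq_bigr => p _; rewrite fgliftU1 -triple_eval_tmap.
rewrite -[triple_eval _ _]comb_eval_tree_words.
have fl : linear (fglift (rooted_word p)) by move=> c u v; rewrite linearP.
rewrite (linear_comb_eval (@word F) _ fl); apply: eq_bigr => x _ /=.
by rewrite fgliftU1.
Qed.

Lemma rooted_perms_nth p i : p \in rooted_perms ->
  (nth 0%N p i <= 5)%N /\ ((i < 5)%N -> nth 0%N p i = 0%N -> i = 0%N).
Proof.
move=> pp; have : all (fun p => (size p == 5) && all (fun i => (nth 0 p i <= 5) &&
   ((nth 0 p i == 0) ==> (i == 0))) (iota 0 5))%N rooted_perms by vm_compute.
move/allP/(_ p pp)/andP=> [/eqP sp /allP H].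
have [i5|i5] := ltnP i 5; last by rewrite nth_default ?sp.
have /H/andP[-> /implyP I0] : i \in iota 0 5 by rewrite mem_iota.
by split=> // _ /eqP/I0/eqP.
Qed.

(** By [minletter_tree_words] the least letter of each word is [p] at the leftmost variable, which
    is not 0; such a word cannot begin with 0. *)
Lemma word_vec_unrooted (t : ttree 'I_5) : leftmost t != ord0 -> word_vec << t >> = 0.
Proof.
move=> lt; rewrite word_vec_tree big_seq big1 // => p pp.
rewrite /comb_eval big_seq big1 // => x xt.
rewrite /rooted_word; case: eqP => [hx|_]; last by rewrite scaler0.
case/eqP: lt; apply: val_inj => /=.
have /= := @minletter_tree_words (nth 0%N p) (tmap val t) x.1
  (fun i => (rooted_perms_nth i pp).1) (map_f fst xt).
rewrite leftmost_tmap /= => m.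
apply: (rooted_perms_nth _ pp).2; first exact: ltn_ord.
rewrite -m; case: (x.1) hx => //= y w ->; exact: min0n.
Qed.

Definition rooted_part : triple_free F 5 -> triple_free F 5 :=
  fglift (fun t => if leftmost t == ord0 then << t >> else 0).

Lemma rooted_part_linear : linear rooted_part.
Proof. by move=> c u v; rewrite /rooted_part linearP. Qed.

Lemma word_vec_rooted_part u : word_vec (rooted_part u) = word_vec u.
Proof.
move: u; apply: freeg_linear_ext => [c u v|c u v|t]; last 1 first.
- rewrite /rooted_part fgliftU1; case: eqP => // /eqP lt.
  by rewrite word_vec_unrooted // (linear_fun0 word_vec_linear).
- by rewrite rooted_part_linear word_vec_linear.
- exact: word_vec_linear.
Qed.

(** Rows take values in monomials times words; by [comb_eval_tree_row], the row of [t] is the point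
    above [t] on the graph of [word_vec]. *)
Definition row_val (k : seq nat) : triple_free F 5 * V :=
  match k with
  | [::] => 0
  | 0%N :: s => (0, word F s)
  | _.+1 :: s => (tree_vec F (decode s), 0)
  end.
Local Notation ev := (comb_eval row_val).

Lemma comb_eval_pair1 (l : comb (ttree nat)) :
  all (fun x => all (ltn^~ 5) (tleaves x.1)) l ->
  ev [seq (1%N :: encode x.1, x.2) | x <- l] = (comb_eval (tree_vec F) l, 0).
Proof.
elim: l => [|x l IH] /=; first by rewrite !comb_eval_nil.
case/andP=> lx /IH {}IH; rewrite !comb_eval_cons IH /= encodeK //.
by congr pair; rewrite /= scaler0 addr0.
Qed.

Lemma comb_eval_encode_comb (l : comb (ttree nat)) :
  all (fun x => all (ltn^~ 5) (tleaves x.1)) l ->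
  ev (encode_comb l) = (comb_eval (tree_vec F) l, 0).
Proof. by move=> ll; rewrite comb_eval_collect comb_eval_pair1. Qed.

Lemma tmap_val_inord t : all (ltn^~ 5) (tleaves t) -> tmap val (tmap (@inord 4) t) = t.
Proof.
move=> /allP t5; rewrite tmap_comp (@eq_in_tmap _ _ _ id) => [|i /t5 i5 /=].
  by elim: {t5} t => //= t1 -> t2 -> t3 ->.
by rewrite inordK.
Qed.

Lemma comb_eval_tree_row t : all (ltn^~ 5) (tleaves t) ->
  ev (tree_row t) = (tree_vec F t, word_vec (tree_vec F t)).
Proof.
move=> t5; rewrite comb_eval_collect comb_eval_cat comb_eval1 [row_val _]/= encodeK //.
rewrite word_vec_tree tmap_val_inord // comb_eval_flatten big_map.
transitivity (\sum_(p <- rooted_perms) (0 : triple_free F 5,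
    comb_eval (rooted_word p) (tree_words (nth 0%N p) t)) + (tree_vec F t, 0)).
  congr (_ + _); apply: eq_bigr => p _.
  elim: (tree_words _ t) => [|x l IH] /=; first by rewrite !comb_eval_nil.
  rewrite !comb_eval_cons /rooted_word; case: eqP => _ /=.
    rewrite comb_eval_cons IH /=; congr pair; first by rewrite /= scaler0 addr0.
  by rewrite IH scaler0 add0r.
elim: rooted_perms => [|p ps IH]; rewrite ?big_nil ?add0r // !big_cons -addrA IH.
by congr pair; rewrite /= add0r.
Qed.

End WordVector.

(** * Generation of the kernel *)

Section Multilinear.
Variables (F : fieldType) (n : nat).
Implicit Types u v : triple_free F n.

Lemma freeg_scaleE (K : choiceType) (u : {freeg K / F}) :
  u = \sum_(t <- dom u) coeff t u *: (<< t >> : {freeg K / F}).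
Proof.
rewrite -[LHS]freeg_sumE; apply: eq_bigr => t _.
by apply/eqP/freeg_eqP => x; rewrite coeffZ !coeffU mul1r.
Qed.

Lemma TT_subspace : subspace (fun u => u \in TT F n).
Proof.
split; first by rewrite unfold_in /TT dom0.
move=> c u v /allP Tu /allP Tv; apply/allP => t /domD_subset.
by rewrite mem_cat => /orP[/domZ_subset/Tu|/Tv].
Qed.

Lemma TT_tree t : perm_eq (tleaves t) (enum 'I_n) -> (<< t >> : triple_free F n) \in TT F n.
Proof. by move=> pt; rewrite unfold_in /TT domU1 /= pt. Qed.

Lemma subspace_sum (W : lmodType F) (Q : W -> Prop) (I : eqType) (r : seq I) (f : I -> W) :
  subspace Q -> {in r, forall i, Q (f i)} -> Q (\sum_(i <- r) f i).
Proof.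
case=> Q0 Ql H; rewrite big_seq; apply: big_ind => // x y Qx Qy.
by rewrite -[x]scale1r; exact: Ql.
Qed.

Lemma Sn_act_linear (s : 'S_n) : linear (@Sn_act F n s).
Proof. by move=> c u v; rewrite /Sn_act linearP. Qed.

Lemma TT_Sn_act (s : 'S_n) u : u \in TT F n -> Sn_act s u \in TT F n.
Proof.
move=> /allP Tu; rewrite [u]freeg_scaleE /Sn_act linear_sum.
apply: (subspace_sum TT_subspace) => t /Tu pt.
rewrite linearZ /= fgliftU1; apply: (subspaceZ TT_subspace); apply: TT_tree.
rewrite tleaves_tmap (perm_trans (perm_map s pt)) //.
apply: uniq_perm; rewrite ?enum_uniq ?(map_inj_uniq (@perm_inj _ s)) ?enum_uniq // => i.
by rewrite mem_enum; apply/mapP; exists (s^-1%g i); rewrite ?mem_enum ?permKV.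
Qed.

End Multilinear.

(** For a monomial only the summand with [i] its leftmost variable survives, and there the
    transposition is applied twice. *)
Lemma rooted_parts_sum (F : fieldType) (u : triple_free F 5) :
  u = \sum_(i : 'I_5) Sn_act (tperm ord0 i) (rooted_part (Sn_act (tperm ord0 i) u)).
Proof.
move: u; apply: freeg_linear_ext => // [c u v|t].
  rewrite scaler_sumr -big_split /=; apply: eq_bigr => i _.
  by rewrite !(Sn_act_linear, @rooted_part_linear F).
rewrite (bigD1 (leftmost t)) //= big1 ?addr0 => [|i it].
  rewrite /Sn_act /rooted_part !fgliftU1 leftmost_tmap tpermR eqxx fgliftU1 tmap_comp.
  congr << _ >>; rewrite -[LHS](_ : tmap id t = t); last by elim: t => //= t1 -> t2 -> t3 ->.
  by apply: eq_in_tmap => j _ /=; rewrite tpermK.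
rewrite /Sn_act /rooted_part !fgliftU1 leftmost_tmap ifF ?linear0 //.
apply/eqP => e; case/eqP: it; apply: (@perm_inj _ (tperm ord0 i)).
by rewrite e tpermR.
Qed.

Section Main.
Variables (F : fieldType) (charF0 : [pchar F] =i pred0).
Local Notation V := (word_algebra F).
Local Notation W := (triple_free F 5 * V)%type.
Local Notation ev := (comb_eval (@row_val F)).
Local Notation tev := (comb_eval (tree_vec F)).
Local Notation G := (generator_vecs F).

Lemma relabel_Sn_act p l : perm_eq p (iota 0 5) ->
  all (fun x => all (ltn^~ 5) (tleaves x.1)) l ->
  exists s : 'S_5, tev (relabel p l) = Sn_act s (tev l).
Proof.
move=> pp ll; pose f (i : 'I_5) : 'I_5 := inord (nth 0%N p i).
have sp : size p = 5%N by rewrite (perm_size pp).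
have p5 i : (i < 5)%N -> (nth 0%N p i < 5)%N.
  move=> i5; have : nth 0%N p i \in iota 0 5 by rewrite -(perm_mem pp) mem_nth ?sp.
  by rewrite mem_iota.
have fI : injective f.
  move=> i j /(congr1 val); rewrite /= !inordK ?p5 // => /eqP.
  by rewrite nth_uniq ?sp ?(perm_uniq pp) // => /eqP/val_inj.
exists (perm fI); rewrite (linear_comb_eval _ _ (@Sn_act_linear F 5 _)) comb_eval_map.
rewrite /comb_eval !big_seq; apply: eq_bigr => x /(allP ll) /allP x5; congr (_ *: _).
rewrite /= /tree_vec /Sn_act fgliftU1 !tmap_comp; congr << _ >>.
by apply: eq_in_tmap => i /x5 i5 /=; rewrite permE /f inordK.
Qed.

Lemma leaves_lt5 t : perm_eq (tleaves t) (iota 0 5) -> all (ltn^~ 5) (tleaves t).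
Proof. by move=> pt; rewrite (perm_all _ pt). Qed.

Lemma generators_lt5 l : l \in generators ->
  all (fun x => all (ltn^~ 5) (tleaves x.1)) l.
Proof. by move/(allP perm_eq_leaves_generators)/allP => H; apply/allP => x /H/leaves_lt5. Qed.

Definition generated (x : W) : Prop := Sn_submodule G x.1 /\ x.2 = 0.

Lemma generated_subspace : subspace generated.
Proof.
split; first by split=> //; exact: SnS_zero.
move=> c x y [x1 x2] [y1 y2]; split; first exact: SnS_lin.
by rewrite /= x2 y2 scaler0 addr0.
Qed.

Lemma generated_relabeled l : l \in relabeled_generators -> generated (ev (encode_comb l)).
Proof.
rewrite mem_filter => /andP[_ /allpairsP[[g p] /= [gG]]]; rewrite mem_permutations => pp ->.
rewrite comb_eval_encode_comb; last first.
  apply/allP => _ /mapP[x xg ->] /=; apply: leaves_lt5.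
  have px := allP (allP perm_eq_leaves_generators _ gG) _ xg.
  rewrite tleaves_tmap (perm_trans (perm_map _ px)) //.
  suff -> : map (nth 0%N p) (iota 0 5%N) = p by [].
  have sp : size p = 5%N by rewrite (perm_size pp).
  by rewrite -sp map_nth_iota0 // take_size.
split=> //; have [s]  := relabel_Sn_act pp (generators_lt5 gG).
move=> /= ->; apply: SnS_act; apply: SnS_gen; exact: map_f.
Qed.

(** Only word keys get a genuine coordinate: [echelon_independent] reads the duality at pivots, and
    the rows concerned have words as pivots. *)
Definition tree_coord (k : seq nat) (x : W) : F^o :=
  if k is 0%N :: s then coeff s x.2 else 0.

Lemma tree_coord_linear k : linear (tree_coord k).
Proof.
by move=> c x y; rewrite /tree_coord; case: k => [|[|m] s];
  rewrite ?scaler0 ?addr0 //= coeffD coeffZ.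
Qed.

(** The rows of [trees] lie in [Q], the span of the rows with a word as pivot enlarged by
    [generated]; hence so does the pair of [rooted_part u] and its word vector. That word vector is
    0, so [echelon_independent] leaves only the part in [generated]. *)
Lemma kernel_spanned_generated trees gens (u : triple_free F 5) :
  kernel_spanned trees gens ->
  (forall t, perm_eq (tleaves t) (iota 0 5) -> leftmost t = 0%N -> t \in trees) ->
  (forall l, l \in gens -> generated (ev (encode_comb l))) ->
  u \in TT F 5 -> word_vec u = 0 -> Sn_submodule G (rooted_part u).
Proof.
rewrite /kernel_spanned; set rows := gauss [::] _; set gen_rows := gauss [::] _.
case/andP=> ech /eqP tail allT gensG /allP Tu wu.
pose R := filter word_pivot rows.
pose Q := span_mod generated (map ev R).
have sQ : subspace Q by apply: span_mod_subspace; exact: generated_subspace.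
have gensP r : r \in gen_rows -> generated (ev r).
  by apply: (subspace_gauss generated_subspace) => // _ /mapP[l lG ->]; exact: gensG.
(* Inserting these rows leaves [gen_rows] unchanged, so by reversibility they lie in every subspace
   that contains [gen_rows]. *)
have tailP r : r \in filter (predC word_pivot) rows -> generated (ev r).
  by apply: (subspace_gauss_inv charF0 generated_subspace (rows := gen_rows) _).2; rewrite tail.
have rowsQ : forall r, r \in rows -> Q (ev r).
  move=> r rr; have [wr|wr] := boolP (word_pivot r).
    apply: span_mod_mem; first exact: generated_subspace.
    by apply: map_f; rewrite mem_filter wr.
  by apply/span_mod_base/tailP; rewrite mem_filter /= wr.
have treeQ := (subspace_gauss_inv charF0 sQ rowsQ).2.
suff [] : generated (rooted_part u, word_vec (rooted_part u)) by [].
apply: (echelon_independent (val := @row_val F) charF0 tree_coord_linear (rows := R)) => //.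
- exact: generated_subspace.
- move=> r k; rewrite mem_filter => /andP[/eqP] wr _ ->.
  case: (pivot r) wr => [//|m s /= ->] [|[|m'] s'] /=; rewrite ?coeff0 ?coeffU ?mul1r //.
- by move=> k y [_ y2]; rewrite /tree_coord; case: k => [|[|m] s]; rewrite ?y2 ?coeff0.
- move=> k; rewrite /tree_coord /= word_vec_rooted_part wu.
  by case: k => [|[|m] s]; rewrite ?coeff0.
have lin : linear (fun v => (rooted_part v, word_vec (rooted_part v)) : W).
  by move=> c v w; rewrite rooted_part_linear word_vec_linear.
rewrite -/Q.
have -> : (rooted_part u, word_vec (rooted_part u)) = \sum_(t <- dom u) coeff t u *:
    ((rooted_part << t >>, word_vec (rooted_part << t >>)) : W).
  pose g : {linear triple_free F 5 -> W} :=
    HB.pack (fun v => (rooted_part v, word_vec (rooted_part v)) : W)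
      (GRing.isLinear.Build F _ _ *:%R _ lin).
  rewrite -[LHS]/(g u) {1}[u]freeg_scaleE linear_sum; apply: eq_bigr => t _.
  by rewrite linearZ.
(* By linearity monomials are enough: one with another leftmost variable contributes 0, the others
   have their row in [Q]. *)
apply: subspace_sum => // t /Tu pt; apply: subspaceZ => //.
rewrite /rooted_part fgliftU1; case: eqP => [lt|_]; last first.
  by rewrite (linear_fun0 (@word_vec_linear F)); case: sQ.
have ptn : perm_eq (tleaves (tmap val t)) (iota 0 5).
  by rewrite tleaves_tmap -val_enum_ord; apply: perm_map.
have tE : tree_vec F (tmap val t) = << t >>.
  rewrite /tree_vec tmap_comp; congr << _ >>.
  rewrite -[RHS](_ : tmap id t = t); last by elim: (t) => //= t1 -> t2 -> t3 ->.
  by apply: eq_in_tmap => i _ /=; rewrite inord_val.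
rewrite -tE -comb_eval_tree_row ?leaves_lt5 //; apply/treeQ/map_f/allT => //.
by rewrite leftmost_tmap lt.
Qed.

Lemma ker_expand_generated (u : triple_free F 5) : u \in ker_expand F 5 -> Sn_submodule G u.
Proof.
case/andP=> Tu /eqP eu; rewrite [u]rooted_parts_sum.
have sG : subspace (Sn_submodule G) by split; [exact: SnS_zero | exact: SnS_lin].
apply: (subspace_sum sG) => i _; apply: SnS_act.
apply: (kernel_spanned_generated kernel_spanned_generators mem_rooted_trees).
- exact: generated_relabeled.
- exact: TT_Sn_act.
rewrite /word_vec big1 // => p _.
(* A permutation of the variables only changes the letters substituted, so the value still factors
   through [expand u], which is 0. *)
rewrite triple_eval_Sn_act -fd_lift_expand eu; set f := (X in fd_lift X).
by have [[fl _ _ _] _] := free_dend_universal f; rewrite (linear_fun0 fl) linear0.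
Qed.

End Main.

(** * The three identities *)

(** The atom number [i] gets the key [[:: i]], so that [collect] serves as the decision procedure
    for abelian groups. *)
Definition atom_val (F : fieldType) (W : lmodType F) (s : seq W) (k : seq nat) : W :=
  nth 0 s (head 0%N k).

Lemma atom_comb_eq (F : fieldType) (W : lmodType F) (s : seq W)
    (l1 l2 : comb (seq nat)) (x y : W) :
  comb_eval (atom_val s) l1 = x -> comb_eval (atom_val s) l2 = y ->
  collect (sub_comb l1 l2) = [::] -> x = y.
Proof.
move=> <- <- l0; apply/eqP; rewrite -subr_eq0 -comb_eval_sub -comb_eval_collect l0.
by rewrite comb_eval_nil.
Qed.

Lemma comb_evalD (F : fieldType) (W : lmodType F) (s : seq W) l1 l2 (x y : W) :
  comb_eval (atom_val s) l1 = x -> comb_eval (atom_val s) l2 = y ->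
  comb_eval (atom_val s) (l1 ++ l2) = x + y.
Proof. by move=> <- <-; rewrite comb_eval_cat. Qed.

Lemma comb_evalN (F : fieldType) (W : lmodType F) (s : seq W) l (x : W) :
  comb_eval (atom_val s) l = x -> comb_eval (atom_val s) (scale_comb (-1) l) = - x.
Proof. by move=> <-; rewrite comb_eval_scale rmorphN scaleN1r. Qed.

Lemma comb_eval_atom (F : fieldType) (W : lmodType F) (s : seq W) i :
  comb_eval (atom_val s) [:: ([:: i], 1)] = nth 0 s i.
Proof. exact: comb_eval1. Qed.

Ltac atom_index x s :=
  lazymatch s with
  | x :: _ => constr:(Some 0%N)
  | _ :: ?s' =>
    lazymatch atom_index x s' with
    | Some ?i => constr:(Some i.+1)
    | None => constr:(@None nat)
    end
  | _ => constr:(@None nat)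
  end.

Ltac add_atoms e s :=
  lazymatch e with
  | 0%R => s
  | (?x + ?y)%R => let s' := add_atoms x s in add_atoms y s'
  | (- ?x)%R => add_atoms x s
  | _ => lazymatch atom_index e s with
         | Some _ => s
         | None => constr:(e :: s)
         end
  end.

Ltac eval_atoms e s :=
  lazymatch e with
  | 0%R => constr:(comb_eval_nil (atom_val s))
  | (?x + ?y)%R => let p := eval_atoms x s in let q := eval_atoms y s in
                   constr:(comb_evalD p q)
  | (- ?x)%R => let p := eval_atoms x s in constr:(comb_evalN p)
  | _ => lazymatch atom_index e s with
         | Some ?i => constr:(comb_eval_atom s i)
         end
  end.

(* Proves equalities that hold in every abelian group, by reflection through
   [collect]; maximal subterms other than sums, opposites and 0 are the atoms. *)
Ltac abelian :=
  lazymatch goal with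
  | |- @eq ?W ?x ?y =>
    let s := add_atoms x (@nil W) in
    let s := add_atoms y s in
    let p := eval_atoms x s in
    let q := eval_atoms y s in
    refine (atom_comb_eq p q _); vm_compute; reflexivity
  end.

Lemma linear_addr (F : fieldType) (U V : lmodType F) (f : U -> V) :
  linear f -> {morph f : x y / x + y}.
Proof. by move=> lf x y; rewrite -{1}[x]scale1r lf scale1r. Qed.

(** * Consequences of right symmetry for a bilinear product *)

Section RightSymmetric.
Variables (F : fieldType) (W : lmodType F) (m : W -> W -> W).
Implicit Types a b c d e x y z : W.
Local Notation "x · y" := (m x y) (at level 40, left associativity).
Hypotheses (linl : forall y, linear (m^~ y)) (linr : forall x, linear (m x)).

(** The associator of [x, y, z] minus that of [x, z, y]. *)
Definition relator x y z : W :=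
  x · y · z - x · (y · z) - (x · z · y - x · (z · y)).

Hypothesis symm : forall x y z, relator x y z = 0.

Let subl z := linear_subr (linl z).
Let subr z := linear_subr (linr z).
Let addl z := linear_addr (linl z).

Lemma right_symmetric_identity1 a b c d e :
  a · b · c · (d · e) - a · (d · e) · b · c
  + a · (d · e · b) · c - a · (b · (d · e)) · c
  + a · b · (d · e · c) - a · b · (c · (d · e)) = 0.
Proof.
(* The terms [a · b · (d · e) · c] of the two relators cancel. *)
transitivity (relator (a · b) c (d · e) + relator a b (d · e) · c).
  by rewrite /relator !(subl, subr); abelian.
by rewrite !symm (linear_fun0 (linl _)) addr0.
Qed.

(** An identity of degree 4 in [a, b, c, d], multiplied on the right by [e]. *)
Lemma right_symmetric_identity2 a b c d e :
  a · b · c · d · e - a · d · b · c · e + a · d · c · b · e - a · c · b · d · e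
  - a · (b · c · d) · e + a · (d · b · c) · e
  - a · (d · c · b) · e + a · (c · b · d) · e = 0.
Proof.
transitivity (
  (relator a b c · d - relator (a · d) b c + relator a d (c · b)
   - relator a d (b · c) + a · relator d b c) · e).
  by rewrite !(subl, addl) /relator !(subl, subr); abelian.
by rewrite !symm !(linear_fun0 (linl _), linear_fun0 (linr _),
   subr0, addr0).
Qed.

Lemma right_symmetric_identity3 a b c d e :
  a · b · c · (d · e) - a · (d · e) · b · c
  + a · (d · e) · (b · c) - a · (b · c) · (d · e)
  + a · (d · e · b) · c + a · (d · e · c) · b
  - a · (b · c · e) · d - a · (d · e · c · b)
  + a · (b · c · e · d) - a · (b · (d · e)) · c
  - a · (c · (d · e)) · b - a · (d · (b · c) · e)
  + a · (b · (d · e) · c) + a · (c · (d · e) · b)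
  + a · d · (b · c · e) - a · (d · (e · (b · c))) = 0.
Proof.
transitivity (
  relator a b (c · (d · e)) - a · relator b c (d · e)
  - relator a b (d · e · c) - relator a (b · c) (d · e)
  + relator a d (b · c · e) + a · relator d e (b · c)
  + relator (a · b) c (d · e) + relator a b (d · e) · c).
  by rewrite /relator !(subl, subr); abelian.
by rewrite !symm !(linear_fun0 (linl _), linear_fun0 (linr _),
   subr0, addr0).
Qed.

End RightSymmetric.

(** Read from left to right, the dendriform axioms bring each product of three factors to a normal
    form, after which all terms cancel. *)
Lemma prelie_right_symmetric (F : fieldType) (D : dendriformType F) (x y z : D) :
  relator (@prelie F D) x y z = 0.
Proof.
have dl t := linear_subr (@dprec_linearl F D t).
have dr t := linear_subr (@dprec_linearr F D t).
have sl t := linear_subr (@dsucc_linearl F D t).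
have sr t := linear_subr (@dsucc_linearr F D t).
rewrite /relator /prelie !(dl, dr, sl, sr) !(dprec_prec, dsucc_succ, dsucc_prec).
abelian.
Qed.

Lemma expand_top1 (F : fieldType) n (u v w : triple_free F n) :
  expand (top1 u v w) = prelie1 (expand u) (expand v) (expand w).
Proof.
move: u v w; apply: trilinear_freeg_ext => [v w|u w|u v|v w|u w|u v|x y z].
- by move=> c u u'; rewrite /expand -linearP; congr fglift; exact: fglift3_linear1.
- by move=> c v v'; rewrite /expand -linearP; congr fglift; exact: fglift3_linear2.
- by move=> c w w'; rewrite /expand -linearP; congr fglift; exact: fglift3_linear3.
- by move=> c u u'; rewrite /expand linearP /prelie1 !prelie_linearl.
- by move=> c v v'; rewrite /expand linearP /prelie1 prelie_linearr prelie_linearl.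
- by move=> c w w'; rewrite /expand linearP /prelie1 prelie_linearr.
- by rewrite /top1 /expand !fgliftU1.
Qed.

Lemma expand_top2 (F : fieldType) n (u v w : triple_free F n) :
  expand (top2 u v w) = prelie2 (expand u) (expand v) (expand w).
Proof.
move: u v w; apply: trilinear_freeg_ext => [v w|u w|u v|v w|u w|u v|x y z].
- by move=> c u u'; rewrite /expand -linearP; congr fglift; exact: fglift3_linear1.
- by move=> c v v'; rewrite /expand -linearP; congr fglift; exact: fglift3_linear2.
- by move=> c w w'; rewrite /expand -linearP; congr fglift; exact: fglift3_linear3.
- by move=> c u u'; rewrite /expand linearP /prelie2 prelie_linearl.
- by move=> c v v'; rewrite /expand linearP /prelie2 prelie_linearl prelie_linearr.
- by move=> c w w'; rewrite /expand linearP /prelie2 !prelie_linearr.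
- by rewrite /top2 /expand !fgliftU1.
Qed.

Lemma expand_identities (F : fieldType) n (a b c d e : triple_free F n) :
  [/\ expand (identity1 a b c d e) = 0, expand (identity2 a b c d e) = 0
    & expand (identity3 a b c d e) = 0].
Proof.
have expl : linear (@expand F n) by move=> k u v; rewrite /expand linearP.
have linl := @prelie_linearl F (free_dend F 'I_n).
have linr := @prelie_linearr F (free_dend F 'I_n).
have symm := @prelie_right_symmetric F (free_dend F 'I_n).
rewrite /identity1 /identity2 /identity3.
rewrite !(linear_subr expl, linear_addr expl) !(expand_top1, expand_top2).
split.
- exact: (right_symmetric_identity1 linl symm).
- exact: (right_symmetric_identity2 linl linr symm).
- exact: (right_symmetric_identity3 linl linr symm).
Qed.

Lemma TT_generator_vecs (F : fieldType) (u : triple_free F 5) :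
  u \in generator_vecs F -> u \in TT F 5.
Proof.
case/mapP=> l lG ->; apply: (subspace_sum (TT_subspace F 5)) => x xl.
apply: (subspaceZ (TT_subspace F 5)); apply: TT_tree; rewrite tleaves_tmap.
have -> : enum 'I_5 = map (@inord 4) (iota 0 5).
  by rewrite -val_enum_ord -map_comp map_id_in // => i _ /=; rewrite inord_val.
exact: perm_map (allP (allP perm_eq_leaves_generators _ lG) _ xl).
Qed.

Theorem theorem4p5 (F : fieldType) (charF0 : [pchar F] =i pred0) :
  let a := tvar F (@Ordinal 5 0 isT) in
  let b := tvar F (@Ordinal 5 1 isT) in
  let c := tvar F (@Ordinal 5 2 isT) in
  let d := tvar F (@Ordinal 5 3 isT) in
  let e := tvar F (@Ordinal 5 4 isT) in
  let ids := [:: identity1 a b c d e; identity2 a b c d e; identity3 a b c d e] in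
  {subset ids <= ker_expand F 5} /\
  (forall t : triple_free F 5, t \in ker_expand F 5 ->
    Sn_submodule (TRS_liftings a b c d e ++ ids) t).
Proof.
move=> a b c d e ids; have gE := generatorsE F; split; last first.
  by move=> t /(ker_expand_generated charF0); rewrite -gE.
move=> u uids; apply/andP; split.
  by apply: TT_generator_vecs; rewrite -gE mem_cat uids orbT.
have [e1 e2 e3] := expand_identities a b c d e.
by move: uids; rewrite !inE => /or3P[] /eqP ->; rewrite ?e1 ?e2 ?e3.
Qed.
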